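(* Let $\mathbf{k}=\mathbb{R}$ or $\mathbf{k}=\mathbb{C}$ and $n\geq1$. Let $(G_m)_{m\in\mathbb{N}}$ be a sequence of subgroups of $\mathrm{Bir}(\mathbb{P}^n_{\mathbf{k}})$ that converges to the identity $\mathrm{id}\in\mathrm{Bir}(\mathbb{P}^n_{\mathbf{k}})$ (with respect to the Euclidean topology). Then $G_m=\{\mathrm{id}\}$ for all $m\gg0$.
   Context: A sequence $(G_m)_m$ of subgroups of a topological group $G$ converges to the neutral element $\mathrm{id}$ if for every open neighbourhood $U$ of $\mathrm{id}$ there is $m_0$ with $G_m\subset U$ for all $m>m_0$. Euclidean topology on $\mathrm{Bir}(\mathbb{P}^n_{\mathbf{k}})$: for $d\geq1$, let $W_d(\mathbf{k})$ be the projective space of classes $[h_0:\dots:h_n]$ of non-zero $(n+1)$-tuples of degree-$d$ homogeneous polynomials in $\mathbf{k}[x_0,\dots,x_n]$ modulo scalars; $H_d(\mathbf{k})\subset W_d(\mathbf{k})$ the subset of $h$ whose rational map $\psi_h\colon[x]\dashrightarrow[h_0(x):\dots:h_n(x)]$ is birational; $\pi_d\colon H_d(\mathbf{k})\to\mathrm{Bir}(\mathbb{P}^n_{\mathbf{k}})_{\leq d}$, $h\mapsto\psi_h$, onto the set of maps of degree $\leq d$. $W_d(\mathbf{k})$ carries the Euclidean topology, $H_d(\mathbf{k})$ the subspace topology, $\mathrm{Bir}(\mathbb{P}^n_{\mathbf{k}})_{\leq d}$ the quotient topology via $\pi_d$, and $\mathrm{Bir}(\mathbb{P}^n_{\mathbf{k}})$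 the inductive limit topology of the $\mathrm{Bir}(\mathbb{P}^n_{\mathbf{k}})_{\leq d}$. *)

(* Defs.v *)
From HB Require Import structures.
From mathcomp Require Import all_boot all_order all_algebra.
From mathcomp Require Import mpoly.
From mathcomp Require Import reals.
From mathcomp Require Import complex.

Set Implicit Arguments.
Unset Strict Implicit.
Unset Printing Implicit Defensive.

Import Order.TTheory GRing.Theory Num.Theory.
Local Open Scope ring_scope.

(* Coordinates x_0, ..., x_n are the n.+1 variables of {mpoly K[n.+1]}.       *)
(* A (lift of a) point of W_d is an (n+1)-tuple h = (h_0,...,h_n) of degree-d *)
(* homogeneous polynomials, not all zero.  Points of W_d are such tuples      *)
(* modulo non-zero scalars; subsets of W_d are represented by scale-invariant *)
(* predicates on such tuples.  Elements of Bir(P^n_K) are represented by      *)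
(* tuples h defining birational maps psi_h, two tuples representing the same  *)
(* element iff they define the same rational map (same_map); subsets of       *)
(* Bir(P^n_K) are represented by predicates on tuples that are saturated for  *)
(* same_map and contain only birational tuples.                               *)

Section Bir.
Variables (K : numFieldType) (n : nat).

Definition ptup := (n.+1).-tuple {mpoly K[n.+1]}.

Definition homog_tuple (d : nat) (h : ptup) : Prop :=
  forall i, tnth h i \is @ishomog1 n.+1 K d mdeg.

Definition nonzero_tuple (h : ptup) : Prop := exists i, tnth h i != 0.

Definition in_W (d : nat) (h : ptup) : Prop := homog_tuple d h /\ nonzero_tuple h.

Definition ratmap (h : ptup) : Prop := exists d, in_W d h.

Definition same_map (h h' : ptup) : Prop :=
  [/\ ratmap h, ratmap h' &
      forall i j, tnth h i * tnth h' j = tnth h j * tnth h' i].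

Definition compt (h g : ptup) : ptup :=
  [tuple comp_mpoly g (tnth h i) | i < n.+1].

Definition idt : ptup := [tuple 'X_i | i < n.+1].

Definition birational (h : ptup) : Prop :=
  ratmap h /\
  exists g, [/\ ratmap g, same_map (compt h g) idt & same_map (compt g h) idt].

Definition in_H (d : nat) (h : ptup) : Prop := in_W d h /\ birational h.

Definition scalet (c : K) (h : ptup) : ptup := map_tuple ( *:%R c) h.

Definition close (eps : K) (h h' : ptup) : Prop :=
  forall i (m : 'X_{1..n.+1}), `|(tnth h i)@_m - (tnth h' i)@_m| < eps.

(* V (a scale-invariant predicate, i.e. a subset of W_d) is open for the
   Euclidean topology of the projective space W_d(K), i.e. its preimage in
   the cone of non-zero coefficient vectors is open *)
Definition openW (d : nat) (V : ptup -> Prop) : Prop :=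
  (forall c h, in_W d h -> c != 0 -> V h -> V (scalet c h)) /\
  (forall h, in_W d h -> V h ->
     exists2 eps, 0 < eps & forall h', in_W d h' -> close eps h h' -> V h').

Definition openH (d : nat) (S : ptup -> Prop) : Prop :=
  exists V, openW d V /\ forall h, in_H d h -> (S h <-> V h).

Definition birset (U : ptup -> Prop) : Prop :=
  (forall h, U h -> birational h) /\
  (forall h h', U h -> birational h' -> same_map h h' -> U h').

(* U is open in Bir(P^n_K) for the Euclidean topology: for every d >= 1,
   U /\ Bir_{<=d} is open in the quotient topology of pi_d, i.e.
   pi_d^{-1}(U) = {h in H_d | psi_h in U} is open in H_d. *)
Definition openBir (U : ptup -> Prop) : Prop :=
  birset U /\ forall d, (1 <= d)%N -> openH d U.

Definition subgroupBir (G : ptup -> Prop) : Prop :=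
  [/\ birset G, G idt,
      (forall h g, G h -> G g -> G (compt h g)) &
      (forall h, G h -> exists2 g, G g & same_map (compt h g) idt)].

Definition cvg_to_id (G : nat -> ptup -> Prop) : Prop :=
  forall U, openBir U -> U idt ->
    exists m0, forall m, (m0 < m)%N -> forall h, G m h -> U h.

End Bir.

(* Main.v *)
Require Import Defs.
From HB Require Import structures.
From mathcomp Require Import all_boot all_order all_algebra.
From mathcomp Require Import ssrcomplements mpoly.
From mathcomp Require Import reals.
From mathcomp Require Import complex.
From mathcomp Require Import boolp.
From mathcomp Require Import ring lra zify.

Set Implicit Arguments.
Unset Strict Implicit.
Unset Printing Implicit Defensive.

Import Order.TTheory GRing.Theory Num.Theory.
Local Open Scope ring_scope.

(* A sequence of subgroups converging to the identity has bounded degree: elements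
   of unbounded degree would form a closed discrete set.  For an element of
   degree <= d represented by an (n+1)-tuple h of degree d, let
   Q(h)_ij = x_i h_j - x_j h_i, which vanishes iff h represents the identity.  If
   h' represents the square of h, then h_0 Q(h') = 2 h'_0 Q(h) up to an error
   quadratic in the size of Q, so with coefficient norms the displacement Q
   doubles along h, h^2, h^4, ..., up to a factor that does not depend on the number
   of steps because ||pq|| >= c ||p|| ||q|| for polynomials of bounded degree.
   Hence, if all elements of a subgroup have displacement <= B with B small, they
   have displacement <= B/2, and iterating they all are the identity.  To see that
   the displacements get small, one uses the open neighbourhoods of the identity
   consisting of the maps that almost fix some point in each of finitely many
   small balls, whose centres determine polynomials of degree d+1. *)

Section NormedField.
(* [nv] is the norm of [K], with values in the real subfield [emb R] pulled back to
   the totally ordered field [R]: the cases of interest are [K = R] and [K = R[i]]. *)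
Variables (R : archiRealFieldType) (K : numFieldType).
Variables (emb : {rmorphism R -> K}) (nv : K -> R).
Hypothesis emb_le : {mono emb : x y / x <= y}.
Hypothesis normE : forall x, `|x| = emb (nv x).

(** * The absolute value of the base field *)

Lemma emb_lt : {mono emb : x y / x < y}.
Proof. exact: leW_mono emb_le. Qed.

Lemma nv_ge0 x : 0 <= nv x.
Proof. by rewrite -emb_le rmorph0 -normE. Qed.

Lemma nv0 : nv 0 = 0.
Proof. by apply: (fmorph_inj emb); rewrite -normE normr0 rmorph0. Qed.

Lemma nv_eq0 x : nv x = 0 -> x = 0.
Proof. by move=> h; apply/eqP; rewrite -normr_eq0 normE h rmorph0. Qed.

Lemma nv_gt0 x : x != 0 -> 0 < nv x.
Proof.
move=> x0; rewrite lt_neqAle nv_ge0 andbT eq_sym.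
by apply: contraNneq x0 => /nv_eq0 ->.
Qed.

Lemma nvM x y : nv (x * y) = nv x * nv y.
Proof. by apply: (fmorph_inj emb); rewrite rmorphM -!normE normrM. Qed.

Lemma nvD x y : nv (x + y) <= nv x + nv y.
Proof. by rewrite -emb_le rmorphD -!normE ler_normD. Qed.

Lemma nvN x : nv (- x) = nv x.
Proof. by apply: (fmorph_inj emb); rewrite -!normE normrN. Qed.

Lemma nvB x y : nv (x - y) <= nv x + nv y.
Proof. by rewrite (le_trans (nvD _ _)) ?nvN. Qed.

Lemma nv_nat k : nv k%:R = k%:R.
Proof. by apply: (fmorph_inj emb); rewrite -normE normr_nat rmorph_nat. Qed.

Lemma nv_emb x : 0 <= x -> nv (emb x) = x.
Proof.
by move=> x0; apply: (fmorph_inj emb); rewrite -normE ger0_norm // -(rmorph0 emb) emb_le.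
Qed.

Lemma nv_natB_ge1 (s t : nat) : s != t -> 1 <= nv (s%:R - t%:R).
Proof.
have gap (u v : nat) : (u < v)%N -> 1 <= nv (v%:R - u%:R).
  by move=> h; rewrite -natrB 1?ltnW // nv_nat ler1n subn_gt0.
case: (ltngtP s t) => // h _; last exact: gap.
by rewrite -nvN opprB gap.
Qed.

(** * Norms of polynomials *)

(** Induction on the number of nodes: in [P = q (X - t) + P(t)] the values of [q] at the other nodes
    are divided differences, at most [2e] because distinct natural nodes are at distance at least 1.
    Hence the constant is uniform in the choice of the nodes. *)
Lemma poly_interpolation_bound (s M : nat) : exists2 C : R, 0 <= C &
  forall (P : {poly K}) (T : seq nat) (e : R),
    (size P <= s)%N -> uniq T -> size T = s -> (forall t, t \in T -> (t <= M)%N) ->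
    0 <= e -> (forall t, t \in T -> nv P.[t%:R] <= e) ->
    forall i, nv P`_i <= C * e.
Proof.
elim: s => [|s [C C0 IH]].
  exists 0 => // P T e; rewrite leqn0 size_poly_eq0 => /eqP -> _ _ _ _ _ i.
  by rewrite coef0 nv0 mul0r.
exists (2 * C * (1 + M%:R) + 1).
  by rewrite addr_ge0 // !mulr_ge0 // addr_ge0.
move=> P [//|t T] e sP /= /andP[tT uT] [sT] TM e0 eT.
have /factor_theorem[q qE] : root (P - P.[t%:R]%:P) t%:R.
  by rewrite rootE !hornerE subrr.
have PE : P = q * ('X - t%:R%:P) + P.[t%:R]%:P by rewrite -qE subrK.
have sq : (size q <= s)%N.
  have [->|q0] := eqVneq q 0; first by rewrite size_poly0.
  have: (size (q * ('X - t%:R%:P))%R <= s.+1)%N.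
    rewrite -qE (leq_trans (size_polyD _ _)) // geq_max sP size_polyN.
    by rewrite (leq_trans (size_polyC_leq1 _)).
  by rewrite size_Mmonic ?monicXsubC // size_XsubC addn2.
have vq t' : t' \in T -> nv q.[t'%:R] <= 2 * e.
  move=> t'T; have neq : t' != t by apply: contraNneq tT => <-.
  have h1 : q.[t'%:R] * (t'%:R - t%:R) = P.[t'%:R] - P.[t%:R].
    by rewrite [in RHS]PE !hornerE /= subrr mulr0 add0r addrK.
  have h2 : nv (q.[t'%:R]) * nv (t'%:R - t%:R) <= 2 * e.
    rewrite -nvM h1 (le_trans (nvB _ _)) // mulr_natl mulr2n.
    by rewrite lerD // eT // inE ?eqxx ?t'T ?orbT.
  apply: le_trans h2; rewrite ler_peMr ?nv_ge0 //; exact: nv_natB_ge1.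
have TM' t' : t' \in T -> (t' <= M)%N by move=> h; apply: TM; rewrite inE h orbT.
have e2 : 0 <= 2 * e by rewrite mulr_ge0.
have cq := IH q T (2 * e) sq uT sT TM' e2 vq.
move=> i; rewrite PE mulrBr coefD coefB coefMX coefMC coefC.
have cq1 j : nv q`_j <= 2 * C * e by rewrite (le_trans (cq j)) // mulrCA mulrA.
have Ce : 0 <= 2 * C * e by rewrite !mulr_ge0.
have h1 : nv (if i == 0%N then 0 else q`_i.-1) <= 2 * C * e.
  by case: ifP => _; rewrite ?nv0 // cq1.
have h2 : nv (q`_i * t%:R) <= 2 * C * e * M%:R.
  by rewrite nvM nv_nat ler_pM ?nv_ge0 ?ler0n ?cq1 // ler_nat TM // inE eqxx.
have h3 : nv (if i == 0%N then P.[t%:R] else 0) <= e.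
  by case: ifP => _; rewrite ?nv0 // eT // inE eqxx.
have := nvD ((if i == 0%N then 0 else q`_i.-1) - q`_i * t%:R)
  (if i == 0%N then P.[t%:R] else 0).
have := nvB (if i == 0%N then 0 else q`_i.-1) (q`_i * t%:R).
lra.
Qed.

Section MultivariateNorm.
Variable n : nat.
Implicit Types (p q : {mpoly K[n]}) (m : 'X_{1..n}).

(** Summing the moduli, rather than taking their maximum, makes the norm submultiplicative, and
    multiplication by a monomial preserves it. *)
Definition mnorm p : R := \sum_(m <- msupp p) nv p@_m.

Lemma mnormwE p k : (msize p <= k)%N ->
  mnorm p = \sum_(m : 'X_{1..n < k}) nv p@_m.
Proof.
move=> le_pk; rewrite /mnorm (big_mksub 'X_{1..n < k}) ?msupp_uniq //=; last first.
  by move=> x /msize_mdeg_lt /leq_trans; apply.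
by rewrite big_rmcond //= => j /memN_msupp_eq0 ->; rewrite nv0.
Qed.

Lemma mnorm_ge0 p : 0 <= mnorm p.
Proof. by apply: sumr_ge0 => m _; apply: nv_ge0. Qed.

Lemma mnorm0 : mnorm 0 = 0.
Proof. by rewrite /mnorm msupp0 big_nil. Qed.

Lemma mcoeff_le_mnorm p m : nv p@_m <= mnorm p.
Proof.
have [mp|/memN_msupp_eq0 ->] := boolP (m \in msupp p); last first.
  by rewrite nv0 mnorm_ge0.
rewrite /mnorm (big_rem m) //= lerDl.
by apply: sumr_ge0 => ? _; apply: nv_ge0.
Qed.

Lemma mnorm_eq0 p : mnorm p = 0 -> p = 0.
Proof.
move=> p0; apply/mpolyP => m; rewrite mcoeff0; apply: nv_eq0.
by apply/eqP; rewrite eq_le nv_ge0 andbT -p0 mcoeff_le_mnorm.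
Qed.

Lemma mnormD p q : mnorm (p + q) <= mnorm p + mnorm q.
Proof.
pose k := maxn (msize p) (msize q).
rewrite !(@mnormwE _ k) ?leq_maxl ?leq_maxr ?msizeD_le // -big_split /=.
by apply: ler_sum => m _; rewrite mcoeffD nvD.
Qed.

Lemma mnormN p : mnorm (- p) = mnorm p.
Proof.
rewrite !(@mnormwE _ (msize p)) ?msizeN //.
by apply: eq_bigr => m _; rewrite mcoeffN nvN.
Qed.

Lemma mnormB p q : mnorm (p - q) <= mnorm p + mnorm q.
Proof. by rewrite (le_trans (mnormD _ _)) ?mnormN. Qed.

Lemma mnormZ c p : mnorm (c *: p) = nv c * mnorm p.
Proof.
rewrite !(@mnormwE _ (msize p)) ?msizeZ_le // mulr_sumr.
by apply: eq_bigr => m _; rewrite mcoeffZ nvM.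
Qed.

Lemma mnormMX p m : mnorm (p * 'X_[m]) = mnorm p.
Proof.
rewrite /mnorm (perm_big _ (msuppMX p m)) /= big_map.
by apply: eq_bigr => m' _; rewrite mcoeffMX.
Qed.

Lemma mnormXM p m : mnorm ('X_[m] * p) = mnorm p.
Proof. by rewrite mulrC mnormMX. Qed.

Lemma mnorm_sum (I : Type) (r : seq I) (F : I -> {mpoly K[n]}) :
  mnorm (\sum_(i <- r) F i) <= \sum_(i <- r) mnorm (F i).
Proof.
elim/big_rec2: _ => [|i y x _ h]; first by rewrite mnorm0.
by rewrite (le_trans (mnormD _ _)) // lerD2l.
Qed.

Lemma mnormM p q : mnorm (p * q) <= mnorm p * mnorm q.
Proof.
rewrite [X in mnorm (X * q)]mpolyE mulr_suml (le_trans (mnorm_sum _ _)) //.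
rewrite /mnorm mulr_suml ler_sum // => m _.
by rewrite -scalerAl -/(mnorm _) mnormZ mnormXM.
Qed.

Lemma mnormC c : mnorm c%:MP = nv c.
Proof.
rewrite /mnorm msuppC; have [->|_] := eqVneq c 0; first by rewrite big_nil nv0.
by rewrite big_seq1 mcoeffC eqxx mulr1.
Qed.

Lemma mnorm_le_coef p k (e : R) : (msize p <= k)%N -> (forall m, nv p@_m <= e) ->
  mnorm p <= #|{: 'X_{1..n < k}}|%:R * e.
Proof.
move=> pk pe; rewrite (mnormwE pk).
apply: (@le_trans _ _ (\sum_(m : 'X_{1..n < k}) e)).
  by apply: ler_sum => m _; apply: pe.
by rewrite sumr_const mulr_natl.
Qed.

Lemma multinom_ind (P : 'X_{1..n} -> Prop) :
  P 0%MM -> (forall i m, P m -> P (U_(i) + m)%MM) -> forall m, P m.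
Proof.
move=> P0 PS m; have [d] := ubnP (mdeg m); elim: d m => // d IH m.
have [->|m0] := eqVneq m 0%MM; first by [].
have [i mi] : exists i, m i != 0%N.
  apply/existsP; apply: contraNT m0 => /existsPn mi.
  by apply/eqP/mnmP => i; rewrite mnm0E; apply/eqP; move: (mi i); rewrite negbK.
have {}mi : (U_(i) <= m)%MM by rewrite lep1mP.
rewrite -(submK mi) addmC mdegD mdeg1 add1n ltnS => dm.
by apply/PS/IH.
Qed.

(** * Substitution estimates, covering both evaluation at points and composition *)

Section Substitution.
Variables (S : comNzRingType) (f : {rmorphism K -> S}) (N : S -> R).
Hypothesis N_ge0 : forall x, 0 <= N x.
Hypothesis ND : forall x y, N (x + y) <= N x + N y.
Hypothesis NM : forall x y, N (x * y) <= N x * N y.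
Hypothesis Nf : forall c, N (f c) <= nv c.
Implicit Types h k : 'I_n -> S.

Lemma mmap1D h m1 m2 : mmap1 h (m1 + m2)%MM = mmap1 h m1 * mmap1 h m2.
Proof. by apply: commr_mmap1_M => i x; apply: mulrC. Qed.

Lemma norm_morph1 : N 1 <= 1.
Proof. by rewrite -(rmorph1 f) (le_trans (Nf _)) // (nv_nat 1). Qed.

Lemma norm_morph0 : N 0 = 0.
Proof. by apply/eqP; rewrite eq_le N_ge0 andbT -(rmorph0 f) (le_trans (Nf _)) // nv0. Qed.

Lemma norm_morph_sum (I : Type) (r : seq I) (F : I -> S) :
  N (\sum_(i <- r) F i) <= \sum_(i <- r) N (F i).
Proof.
elim/big_rec2: _ => [|i y x _ h]; first by rewrite norm_morph0.
by rewrite (le_trans (ND _ _)) // lerD2l.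
Qed.

Lemma mmap1_bound h (M : R) m : 1 <= M -> (forall i, N (h i) <= M) ->
  N (mmap1 h m) <= M ^+ mdeg m.
Proof.
move=> M1 hM; elim/multinom_ind: m => [|i m IH].
  by rewrite mmap11 mdeg0 expr0 norm_morph1.
rewrite mmap1D mmap1U mdegD mdeg1 add1n exprS (le_trans (NM _ _)) //.
by rewrite ler_pM ?N_ge0.
Qed.

Lemma mmap_bound h (M : R) e p : 1 <= M -> (forall i, N (h i) <= M) ->
  (msize p <= e.+1)%N -> N (mmap f h p) <= mnorm p * M ^+ e.
Proof.
move=> M1 hM pe; rewrite /mmap (le_trans (norm_morph_sum _ _)) //.
rewrite /mnorm mulr_suml big_seq [X in _ <= X]big_seq ler_sum // => m mp.
rewrite (le_trans (NM _ _)) // ler_pM ?N_ge0 ?Nf //.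
rewrite (le_trans (mmap1_bound m M1 hM)) // ler_weXn2l //.
by rewrite -ltnS (leq_trans (msize_mdeg_lt mp)).
Qed.

(** The product rule [hu - kv = h (u - v) + (h - k) v] is applied one variable at a time, so each
    variable of the monomial contributes one [delta]. *)
Lemma mmap1_lipschitz h k (M delta : R) m : 1 <= M -> 0 <= delta ->
  (forall i, N (h i) <= M) -> (forall i, N (k i) <= M) ->
  (forall i, N (h i - k i) <= delta) ->
  N (mmap1 h m - mmap1 k m) <= (mdeg m)%:R * M ^+ mdeg m * delta.
Proof.
move=> M1 d0 hM kM hk; have M0 : 0 <= M by apply: le_trans M1.
elim/multinom_ind: m => [|i m IH].
  by rewrite !mmap11 subrr norm_morph0 mdeg0 !mul0r.
rewrite !mmap1D !mmap1U mdegD mdeg1 add1n exprS.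
set u := mmap1 h m in IH *; set v := mmap1 k m in IH *.
have -> : h i * u - k i * v = h i * (u - v) + (h i - k i) * v by ring.
have vM : N v <= M ^+ mdeg m by apply: mmap1_bound.
apply: le_trans (ND _ _) _.
have h1 : N (h i * (u - v)) <= M * ((mdeg m)%:R * M ^+ mdeg m * delta).
  by rewrite (le_trans (NM _ _)) // ler_pM.
have h2 : N ((h i - k i) * v) <= delta * (M * M ^+ mdeg m).
  rewrite (le_trans (NM _ _)) // ler_pM // (le_trans vM) //.
  by rewrite ler_peMl // exprn_ge0.
apply: le_trans (lerD h1 h2) _.
by rewrite -[X in _ <= X%:R * _ * _]addn1 natrD le_eqVlt; apply/orP; left; apply/eqP; ring.
Qed.

Lemma mmap_lipschitz h k (M delta : R) e p : 1 <= M -> 0 <= delta ->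
  (forall i, N (h i) <= M) -> (forall i, N (k i) <= M) ->
  (forall i, N (h i - k i) <= delta) -> (msize p <= e.+1)%N ->
  N (mmap f h p - mmap f k p) <= mnorm p * (e%:R * M ^+ e * delta).
Proof.
move=> M1 d0 hM kM hk pe; have M0 : 0 <= M by apply: le_trans M1.
rewrite /mmap -sumrB (le_trans (norm_morph_sum _ _)) //.
rewrite /mnorm mulr_suml big_seq [X in _ <= X]big_seq ler_sum // => m mp.
rewrite -mulrBr (le_trans (NM _ _)) // ler_pM ?N_ge0 ?Nf //.
rewrite (le_trans (mmap1_lipschitz m M1 d0 hM kM hk)) //.
have me : (mdeg m <= e)%N by rewrite -ltnS (leq_trans (msize_mdeg_lt mp)).
by rewrite ler_pM ?mulr_ge0 ?exprn_ge0 // ler_pM ?exprn_ge0 ?ler_nat // ler_weXn2l.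
Qed.

Lemma mmap_homog c h d p : p \is d.-homog for mdeg ->
  mmap f (fun i => c * h i) p = c ^+ d * mmap f h p.
Proof.
move=> /dhomogP hp; rewrite /mmap mulr_sumr big_seq [RHS]big_seq.
apply: eq_bigr => m mp; rewrite mulrCA; congr (_ * _).
have <- : mdeg m = d by apply: hp.
rewrite /mmap1 mdegE -prodrXr -big_split /=.
by apply: eq_bigr => i _; rewrite exprMn.
Qed.

End Substitution.

Lemma mpolyC_norm_le c : mnorm (c%:MP : {mpoly K[n]}) <= nv c.
Proof. by rewrite mnormC. Qed.

Lemma meval_bound (x : 'I_n -> K) (M : R) e p : 1 <= M -> (forall i, nv (x i) <= M) ->
  (msize p <= e.+1)%N -> nv p.@[x] <= mnorm p * M ^+ e.
Proof. by apply: (@mmap_bound K idfun nv nv_ge0 nvD) => // *; rewrite nvM. Qed.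

Lemma meval_lipschitz (x y : 'I_n -> K) (M delta : R) e p : 1 <= M -> 0 <= delta ->
  (forall i, nv (x i) <= M) -> (forall i, nv (y i) <= M) ->
  (forall i, nv (x i - y i) <= delta) -> (msize p <= e.+1)%N ->
  nv (p.@[x] - p.@[y]) <= mnorm p * (e%:R * M ^+ e * delta).
Proof. by apply: (@mmap_lipschitz K idfun nv nv_ge0 nvD) => // *; rewrite nvM. Qed.

Lemma comp_mpoly_lipschitz (g h : n.-tuple {mpoly K[n]}) (M delta : R) e p :
  1 <= M -> 0 <= delta ->
  (forall i, mnorm (tnth g i) <= M) -> (forall i, mnorm (tnth h i) <= M) ->
  (forall i, mnorm (tnth g i - tnth h i) <= delta) -> (msize p <= e.+1)%N ->
  mnorm ((p \mPo g) - (p \mPo h)) <= mnorm p * (e%:R * M ^+ e * delta).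
Proof.
exact: (@mmap_lipschitz {mpoly K[n]} (@mpolyC n K) mnorm mnorm_ge0 mnormD mnormM
  mpolyC_norm_le).
Qed.

(** * Kronecker substitution and norms of products *)

Definition kronecker_weight (b : nat) m : nat := \sum_(i < n) m i * b ^ i.

(** The entries of [m] are the digits of its weight in base [b]; digits are recovered by reducing
    modulo [b] and then dividing by [b]. *)
Lemma kronecker_weight_inj b m1 m2 :
  (mdeg m1 < b)%N -> (mdeg m2 < b)%N ->
  kronecker_weight b m1 = kronecker_weight b m2 -> m1 = m2.
Proof.
have digits k (u v : nat -> nat) : (forall i, u i < b)%N -> (forall i, v i < b)%N ->
    (\sum_(i < k) u i * b ^ i = \sum_(i < k) v i * b ^ i)%N ->
    forall i, (i < k)%N -> u i = v i.
  elim: k u v => [//|k IH] u v ub vb.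
  have shift (w : nat -> nat) :
      (\sum_(i < k.+1) w i * b ^ i = (\sum_(i < k) w i.+1 * b ^ i) * b + w 0)%N.
    rewrite big_ord_recl expn0 muln1 addnC big_distrl /=; congr (_ + _)%N.
    by apply: eq_bigr => i _; rewrite expnSr mulnA.
  rewrite !shift => E.
  have b0 : (0 < b)%N by apply: leq_ltn_trans (ub 0%N).
  have E0 : u 0%N = v 0%N.
    by move/(congr1 (modn^~ b)): E; rewrite /= !modnMDl !modn_small.
  case=> [|i] // ik; apply: (IH (u \o succn) (v \o succn)) => //=.
  by apply/eqP; rewrite -(eqn_pmul2r b0); move/eqP: E; rewrite E0 eqn_add2r.
have entry m (i : 'I_n) : (m i <= mdeg m)%N.
  by rewrite mdegE (bigD1 i) //= leq_addr.
move=> h1 h2 E; apply/mnmP => i.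
have b0 : (0 < b)%N by apply: leq_ltn_trans h1.
(* Exponents are extended by zero beyond [n], since [digits] speaks of functions on all naturals. *)
pose w m j : nat := if insub j is Some i then m (i : 'I_n) else 0%N.
have wE m (j : 'I_n) : w m j = m j by rewrite /w valK.
have wb m : (mdeg m < b)%N -> forall j, (w m j < b)%N.
  move=> mb j; rewrite /w; case: insubP => //= i' _ _.
  exact: leq_ltn_trans (entry m i') mb.
rewrite -!wE; apply: (digits n) => //; do ?exact: wb.
by under eq_bigr do rewrite wE; under [RHS]eq_bigr do rewrite wE.
Qed.

Definition kronecker_point (b t : nat) : 'I_n -> K := fun i => t%:R ^+ (b ^ i).

(** Along the curve of Kronecker points, a polynomial of degree less than [b] becomes a one-variable
    polynomial with the same coefficients at distinct exponents. The number [s] of nodes is fixed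
    before their range [M], so [M] may be chosen in terms of [s]. *)
Lemma kronecker_interpolation (b : nat) : exists s : nat, forall M : nat,
  exists2 C : R, 0 < C &
  forall p (T : seq nat) (e : R),
    (msize p <= b)%N -> uniq T -> size T = s -> (forall t, t \in T -> (t <= M)%N) ->
    0 <= e -> (forall t, t \in T -> nv p.@[kronecker_point b t] <= e) ->
    mnorm p <= C * e.
Proof.
pose s := (\max_(m : 'X_{1..n < b}) (kronecker_weight b m).+1)%N.
exists s => M; have [C C0 HC] := poly_interpolation_bound s M.
set c := #|{: 'X_{1..n < b}}|%:R : R.
exists (c * C + 1); first by rewrite ltr_wpDl // mulr_ge0.
move=> p T e pb uT sT TM e0 pe.
pose P : {poly K} := \sum_(m : 'X_{1..n < b}) p@_m *: 'X^(kronecker_weight b m).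
have Pev (t : nat) : P.[t%:R] = p.@[kronecker_point b t].
  rewrite /P horner_sum /meval (mmapE b) //; apply: eq_bigr => m _.
  rewrite hornerZ hornerXn /=; congr (_ * _); rewrite /mmap1 expr_sum.
  by apply: eq_bigr => i _; rewrite /kronecker_point -exprM mulnC.
have sP : (size P <= s)%N.
  apply: leq_trans (size_sum _ _ _) _; apply/bigmax_leqP => m _.
  rewrite (leq_trans (size_scale_leq _ _)) // size_polyXn.
  exact: (leq_bigmax (F := fun m : 'X_{1..n < b} => (kronecker_weight b m).+1)).
have coefP (m : 'X_{1..n < b}) : P`_(kronecker_weight b m) = p@_m.
  rewrite /P coef_sum (bigD1 m) //= coefZ coefXn eqxx mulr1 big1 ?addr0 //.
  move=> m' mm'; rewrite coefZ coefXn; case: eqP => [E|]; last by rewrite mulr0.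
  case/eqP: mm'; apply: val_inj.
  by apply: (@kronecker_weight_inj b); rewrite ?bmdeg.
have {}HC i : nv P`_i <= C * e.
  by apply: HC uT sT TM e0 _ _ => // t tT; rewrite Pev pe.
apply: (@le_trans _ _ (c * (C * e))); last by rewrite mulrDl mul1r mulrA lerDl.
rewrite (mnormwE pb).
apply: (@le_trans _ _ (\sum_(m : 'X_{1..n < b}) (C * e))).
  by apply: ler_sum => m _; rewrite -coefP.
by rewrite sumr_const mulr_natl.
Qed.

Lemma kronecker_point_bound (b M : nat) : exists2 B : R, 1 <= B &
  forall t i, (t <= M)%N -> nv (kronecker_point b t i) <= B.
Proof.
exists (M.+1%:R ^+ (\sum_(j < n) b ^ j)%N); first by rewrite exprn_ege1 // ler1n.
move=> t i tM; rewrite /kronecker_point -natrX nv_nat -natrX ler_nat.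
apply: (@leq_trans (M.+1 ^ (b ^ i))); first by case: (b ^ i)%N => // k; rewrite leq_exp2r // leqW.
by rewrite leq_pexp2l // (bigD1 i) //= leq_addr.
Qed.

(* Each factor is small at fewer than [s] of the [2s] Kronecker points, so some
   point is good for both. *)
Lemma mnormM_ge (D : nat) : exists2 c : R, 0 < c &
  forall p q, (msize p <= D)%N -> (msize q <= D)%N ->
    c * (mnorm p * mnorm q) <= mnorm (p * q).
Proof.
have [s /(_ s.*2)[C C0 HC]] := kronecker_interpolation D.
have [B B1 HB] := kronecker_point_bound D s.*2.
have B0 : 0 < B by apply: lt_le_trans B1.
(* If [p] were this small at [s] nodes, interpolation would give [mnorm p <= mnorm p / 2]. *)
pose bad p t := nv p.@[kronecker_point D t] <= mnorm p / (2 * C).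
have bad_lt p : (msize p <= D)%N -> 0 < mnorm p -> (count (bad p) (iota 0 s.*2) < s)%N.
  move=> pD p0; rewrite ltnNge -size_filter; apply/negP => big.
  set L := [seq t <- iota 0 s.*2 | bad p t] in big.
  have sub : {subset take s L <= L} by exact: mem_take.
  have : mnorm p <= C * (mnorm p / (2 * C)).
    apply: (HC p (take s L)) => //.
    - by rewrite take_uniq // filter_uniq // iota_uniq.
    - by rewrite size_takel.
    - by move=> t /sub; rewrite mem_filter mem_iota => /andP[_] /andP[_ /ltnW].
    - by rewrite divr_ge0 ?mulr_ge0 // ltW.
    - by move=> t /sub; rewrite mem_filter => /andP[].
  have -> : C * (mnorm p / (2 * C)) = mnorm p / 2 by field; rewrite gt_eqF.
  lra.
(* Each factor loses [2C] at a good node, and evaluating [p * q] there multiplies its norm by at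
   most [B ^+ (D + D)]. *)
exists ((2 * C * (2 * C) * B ^+ (D + D))^-1).
  by rewrite invr_gt0 !mulr_gt0 // exprn_gt0.
move=> p q pD qD.
have [p0|p0] := eqVneq (mnorm p) 0; first by rewrite p0 mul0r mulr0 mnorm_ge0.
have [q0|q0] := eqVneq (mnorm q) 0; first by rewrite q0 !mulr0 mnorm_ge0.
have {}p0 : 0 < mnorm p by rewrite lt_neqAle eq_sym p0 mnorm_ge0.
have {}q0 : 0 < mnorm q by rewrite lt_neqAle eq_sym q0 mnorm_ge0.
have [t tI tgood] : exists2 t, t \in iota 0 s.*2 & ~~ bad p t && ~~ bad q t.
  apply/hasP; apply: contraT; rewrite -all_predC => /allP cover.
  have /eqP : count (predU (bad p) (bad q)) (iota 0 s.*2) == size (iota 0 s.*2).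
    rewrite -all_count; apply/allP => t /cover /=.
    by rewrite negb_and !negbK.
  rewrite size_iota => E.
  have := count_predUI (bad p) (bad q) (iota 0 s.*2); rewrite E.
  have := bad_lt p pD p0; have := bad_lt q qD q0.
  move: (count _ _) (count _ _) (count _ _) => a b c; lia.
have tM : (t <= s.*2)%N by move: tI; rewrite mem_iota => /andP[_ /ltnW].
move: tgood; rewrite -!ltNge => /andP[tp tq].
have up : nv p.@[kronecker_point D t] * nv q.@[kronecker_point D t]
    <= mnorm (p * q) * B ^+ (D + D).
  rewrite -nvM -mevalM; apply: meval_bound => //; first by move=> i; apply: HB.
  by apply: leq_trans (msizeM_le _ _) _; rewrite ltnS leq_add.
have low : mnorm p / (2 * C) * (mnorm q / (2 * C)) <=
    nv p.@[kronecker_point D t] * nv q.@[kronecker_point D t].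
  by rewrite ler_pM ?divr_ge0 ?mulr_ge0 ?mnorm_ge0 // ltW.
rewrite mulrC ler_pdivrMr ?mulr_gt0 ?exprn_gt0 //.
rewrite -(ler_pM2r (_ : 0 < (2 * C * (2 * C))^-1)); last by rewrite invr_gt0 !mulr_gt0.
have -> : mnorm p * mnorm q * (2 * C * (2 * C))^-1 =
    mnorm p / (2 * C) * (mnorm q / (2 * C)) by field; rewrite gt_eqF.
have -> : mnorm (p * q) * (2 * C * (2 * C) * B ^+ (D + D)) * (2 * C * (2 * C))^-1 =
    mnorm (p * q) * B ^+ (D + D) by field; rewrite gt_eqF.
exact: le_trans low up.
Qed.

(** Factors [a] are peeled off one by one; the remaining product [a * p] has larger degree, so the
    induction keeps [D2] general. *)
Lemma mnorm_expM_ge (k D1 D2 : nat) : exists2 c : R, 0 < c &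
  forall a p, (msize a <= D1)%N -> (msize p <= D2)%N ->
    c * (mnorm a ^+ k * mnorm p) <= mnorm (a ^+ k * p).
Proof.
elim: k D2 => [|k IH] D2; first by exists 1 => // a p _ _; rewrite !expr0 !mul1r.
have [c1 c10 H1] := mnormM_ge (D1 + D2); have [c2 c20 H2] := IH (D1 + D2).+1.
exists (c2 * c1) => [|a p aD pD]; first by rewrite mulr_gt0.
have apD : (msize (a * p)%R <= (D1 + D2).+1)%N.
  by apply: leq_trans (msizeM_le _ _) _; rewrite ltnS leq_add.
have -> : a ^+ k.+1 * p = a ^+ k * (a * p) by rewrite exprSr mulrA.
apply: le_trans (H2 _ _ aD apD).
have -> : c2 * c1 * (mnorm a ^+ k.+1 * mnorm p) =
  c2 * (mnorm a ^+ k * (c1 * (mnorm a * mnorm p))) by rewrite exprSr; ring.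
rewrite ler_pM2l // ler_wpM2l ?exprn_ge0 ?mnorm_ge0 //.
by apply: H1; rewrite (leq_trans aD, leq_trans pD) // (leq_addr, leq_addl).
Qed.

Lemma dhomog_msize_le d p : p \is d.-homog for mdeg -> (msize p <= d.+1)%N.
Proof.
move=> /dhomogP hp; rewrite msizeE; apply/bigmax_leqP_seq => m mp _.
by rewrite ltnS; have -> : mdeg m = d by apply: hp.
Qed.

Lemma comp_mpoly_homog c (h : n.-tuple {mpoly K[n]}) d p : p \is d.-homog for mdeg ->
  p \mPo [tuple c * tnth h i | i < n] = c ^+ d * (p \mPo h).
Proof.
move=> hp; rewrite -(mmap_homog (@mpolyC n K) c (tnth h) hp) /comp_mpoly /mmap.
apply: eq_bigr => m _; congr (_ * _); apply: mmap1_eq => i.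
by rewrite tnth_mktuple.
Qed.

Lemma mnormX_le1 a k : mnorm a <= 1 -> mnorm (a ^+ k) <= 1.
Proof.
move=> a1; elim: k => [|k IH]; first by rewrite expr0 -mpolyC1 mnormC (nv_nat 1).
by rewrite exprS (le_trans (mnormM _ _)) // mulr_ile1 ?mnorm_ge0.
Qed.

Lemma mnormM_le p q (x y : R) : mnorm p <= x -> mnorm q <= y -> mnorm (p * q) <= x * y.
Proof. by move=> px qy; rewrite (le_trans (mnormM _ _)) // ler_pM ?mnorm_ge0. Qed.

Lemma mnormD_le p q (x y : R) : mnorm p <= x -> mnorm q <= y -> mnorm (p + q) <= x + y.
Proof. by move=> px qy; rewrite (le_trans (mnormD _ _)) // lerD. Qed.

Lemma mnormB_le p q (x y : R) : mnorm p <= x -> mnorm q <= y -> mnorm (p - q) <= x + y.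
Proof. by move=> px qy; rewrite (le_trans (mnormB _ _)) // lerD. Qed.

(* If [H = a x + r] with [r] of order [rho], then
   [H o H = (a o H) H + r o H = a^(d+2) x + s] with
   [s = 2 a^(d+1) r + (multiple of x) + O(rho^2)]: squaring a map doubles its
   displacement up to second order. *)
Lemma displacement_double d : exists2 C : R, 0 <= C &
  forall (a a' : {mpoly K[n]}) (r r' : 'I_n -> {mpoly K[n]})
    (H H' : n.-tuple {mpoly K[n]}) (rho : R),
    a \is d.-homog for mdeg -> (forall i, r i \is d.+1.-homog for mdeg) ->
    (forall i, tnth H i = a * 'X_i + r i) ->
    (forall i, tnth H' i = a' * 'X_i + r' i) ->
    (forall i j, tnth H' i * (tnth H j \mPo H) = tnth H' j * (tnth H i \mPo H)) ->
    mnorm a <= 1 -> mnorm a' <= 1 -> 0 <= rho <= 1 ->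
    (forall i, mnorm (r i) <= rho) -> (forall i, mnorm (r' i) <= rho) ->
    forall i j,
      mnorm (a ^+ d.+1 * (a * ('X_i * r' j - 'X_j * r' i)
                          - 2 *: (a' * ('X_i * r j - 'X_j * r i)))) <= C * rho ^+ 2.
Proof.
(* Lipschitz constant of substituting tuples of norm at most 2 into forms of degree at most [d + 1]
   and norm 1. *)
pose L : R := d.+1%:R * 2 ^+ d.+1.
have L0 : 0 <= L by rewrite mulr_ge0 // exprn_ge0.
exists (10 * L + 4); first by lra.
move=> a a' r r' H H' rho ha hr HE H'E par a1 a'1 /andP[rho0 rho1] rrho r'rho i j.
have X1 k : mnorm ('X_k : {mpoly K[n]}) <= 1.
  by rewrite -[X in mnorm X]mulr1 mnormXM -mpolyC1 mnormC (nv_nat 1).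
(* [A] is the identity written as [a x]: substituting it into a form of degree [e] multiplies the
   form by [a ^+ e]. *)
pose A : n.-tuple {mpoly K[n]} := [tuple a * tnth [tuple 'X_i | i < n] i | i < n].
have AE k : tnth A k = a * 'X_k by rewrite !tnth_mktuple.
have compA e p : p \is e.-homog for mdeg -> p \mPo A = a ^+ e * p.
  by move=> hp; rewrite (comp_mpoly_homog _ _ hp) comp_mpoly_id.
have A2 k : mnorm (tnth A k) <= 2.
  by rewrite AE (le_trans (mnormM_le a1 (X1 k))) //; lra.
have H2 k : mnorm (tnth H k) <= 2.
  rewrite HE (le_trans (mnormD_le (mnormM_le a1 (X1 k)) (rrho k))) //; lra.
have HA k : mnorm (tnth H k - tnth A k) <= rho by rewrite HE AE addrC addKr.
have lip e p : (e <= d.+1)%N -> p \is e.-homog for mdeg ->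
    mnorm ((p \mPo H) - a ^+ e * p) <= mnorm p * (L * rho).
  move=> ed hp; rewrite -compA //.
  apply: le_trans (comp_mpoly_lipschitz _ rho0 H2 A2 HA (dhomog_msize_le hp)) _.
    by lra.
  rewrite ler_wpM2l ?mnorm_ge0 // ler_wpM2r // ler_pM ?exprn_ge0 ?ler_nat //.
  by rewrite ler_weXn2l //; lra.
set P := a ^+ d.+1.
have P1 : mnorm P <= 1 by apply: mnormX_le1.
pose al := (a \mPo H) - P.
have al_le : mnorm al <= L * rho.
  have := lip _ _ (leqnSn d) ha; rewrite -exprSr => /le_trans; apply.
  by rewrite ler_piMl // mulr_ge0.
pose be k := (r k \mPo H) - P * r k.
have be_le k : mnorm (be k) <= L * rho ^+ 2.
  have := lip _ _ (leqnn _) (hr k) => /le_trans; apply.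
  have -> : L * rho ^+ 2 = rho * (L * rho) by ring.
  by apply: ler_wpM2r; [apply: mulr_ge0|apply: rrho].
pose s k := al * a * 'X_k + 2 *: (P * r k) + al * r k + be k.
have two_le p (x : R) : mnorm p <= x -> mnorm (2 *: p) <= 2 * x.
  by move=> px; rewrite mnormZ (nv_nat 2) ler_wpM2l.
have rho2 : rho ^+ 2 <= rho by rewrite expr2 ler_piMl.
have s_le k : mnorm (s k) <= (3 * L + 2) * rho.
  apply: le_trans (mnormD_le (mnormD_le (mnormD_le
    (mnormM_le (mnormM_le al_le a1) (X1 k)) (two_le _ _ (mnormM_le P1 (rrho k))))
    (mnormM_le al_le (rrho k))) (be_le k)) _.
  have : L * rho ^+ 2 <= L * rho by rewrite ler_wpM2l.
  rewrite expr2; lra.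
have HHE k : tnth H k \mPo H = P * a * 'X_k + s k.
  rewrite {1}HE comp_mpolyD rmorphM /= comp_mpolyXU -tnth_nth HE.
  rewrite /s /be /al -!mul_mpolyC; have -> : (2%:MP : {mpoly K[n]}) = 2 by rewrite mpolyC_nat.
  by ring.
(* Expand the vanishing minors of [H'] and [H o H]. The multiple [al * a * 'X_k] of [x] in [s]
   cancels in ['X_i * s j - 'X_j * s i], and every remaining error term is of second order in
   [rho]. *)
have -> : P * (a * ('X_i * r' j - 'X_j * r' i) - 2 *: (a' * ('X_i * r j - 'X_j * r i))) =
    a' * (al * ('X_i * r j - 'X_j * r i) + ('X_i * be j - 'X_j * be i))
    + (r' i * s j - r' j * s i).
  apply/eqP; rewrite -subr_eq0; apply/eqP.
  have /eqP := par j i; rewrite -subr_eq0 => /eqP <-.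
  rewrite !HHE !H'E /s -!mul_mpolyC.
  have -> : (2%:MP : {mpoly K[n]}) = 2 by rewrite mpolyC_nat.
  by ring.
apply: le_trans (mnormD_le (mnormM_le a'1 (mnormD_le
  (mnormM_le al_le (mnormB_le (mnormM_le (X1 i) (rrho j)) (mnormM_le (X1 j) (rrho i))))
  (mnormB_le (mnormM_le (X1 i) (be_le j)) (mnormM_le (X1 j) (be_le i)))))
  (mnormB_le (mnormM_le (r'rho i) (s_le j)) (mnormM_le (r'rho j) (s_le i)))) _.
rewrite le_eqVlt; apply/orP; left; apply/eqP; ring.
Qed.

End MultivariateNorm.

(** * Displacement of rational maps *)

Section Tuples.
Variable n : nat.
Implicit Types (h g : ptup K n).

Definition tnorm h : R := \sum_i mnorm (tnth h i).

(* The 2x2 minors of [(x, h)]; they all vanish iff [h] represents the identity. *)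
Definition displ h i j : {mpoly K[n.+1]} := 'X_i * tnth h j - 'X_j * tnth h i.

Definition dnorm h : R := \sum_i \sum_j mnorm (displ h i j).

Definition parallel h g : Prop := forall i j, tnth h i * tnth g j = tnth h j * tnth g i.

Lemma tnth_le_tnorm h i : mnorm (tnth h i) <= tnorm h.
Proof.
rewrite /tnorm (bigD1 i) //= lerDl.
by apply: sumr_ge0 => *; apply: mnorm_ge0.
Qed.

Lemma displ_le_dnorm h i j : mnorm (displ h i j) <= dnorm h.
Proof.
rewrite /dnorm (bigD1 i) //= (bigD1 j) //= -addrA lerDl.
by rewrite addr_ge0 // sumr_ge0 // => *; rewrite ?mnorm_ge0 ?sumr_ge0 // => *;
   apply: mnorm_ge0.
Qed.

Lemma dnorm_ge0 h : 0 <= dnorm h.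
Proof. by rewrite !sumr_ge0 // => i _; rewrite sumr_ge0 // => j _; apply: mnorm_ge0. Qed.

(** Since [x_0 h_i = x_i h_0 + displ h ord0 i] and variables preserve the norm, the first coordinate
    and the displacement control all coordinates. *)
Lemma tnorm_le_first h : tnorm h <= n.+1%:R * (mnorm (tnth h ord0) + dnorm h).
Proof.
apply: (@le_trans _ _ (\sum_(i < n.+1) (mnorm (tnth h ord0) + dnorm h))).
  apply: ler_sum => i _; rewrite -(mnormXM _ U_(ord0)).
  have -> : 'X_ord0 * tnth h i = 'X_i * tnth h ord0 + displ h ord0 i.
    by rewrite /displ; ring.
  by rewrite (mnormD_le _ (displ_le_dnorm h _ _)) // mnormXM.
by rewrite sumr_const card_ord mulr_natl.
Qed.

(** This lower bound allows division by [h_0] at a cost independent of [h]. *)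
Lemma first_ge h : tnorm h = 1 -> dnorm h <= (2 * n.+1%:R)^-1 ->
  (2 * n.+1%:R)^-1 <= mnorm (tnth h ord0).
Proof.
move=> h1 hd; have := tnorm_le_first h; rewrite h1.
set m := mnorm _; set N := n.+1%:R : R => hm.
have N0 : 0 < N by rewrite ltr0n.
have E : N * (2 * N)^-1 = 2^-1 by rewrite invfM mulrCA mulfV ?mulr1 // gt_eqF.
have : N * (2 * N)^-1 <= N * m.
  have : N * dnorm h <= N * (2 * N)^-1 by rewrite ler_pM2l.
  rewrite mulrDr in hm; rewrite E => hd'.
  by move: hm hd'; move: (N * m) (N * dnorm h) => u v; lra.
by rewrite ler_pM2l.
Qed.

Lemma mpolyXU_homog k : ('X_k : {mpoly K[n.+1]}) \is 1.-homog for mdeg.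
Proof. by rewrite dhomogX; apply/eqP; exact: mdeg1. Qed.

Lemma displ_homog d h i j : homog_tuple d h -> displ h i j \is d.+1.-homog for mdeg.
Proof.
move=> hh; rewrite /displ -[d.+1]add1n.
by apply: rpredB; apply: dhomogM; rewrite ?mpolyXU_homog //; apply: hh.
Qed.

(** [displacement_double] applies to [x_0 h = h_0 x + displ h ord0], with [h_0] as [a]. The
    resulting factor [h_0 ^+ d.+1] is divided out by [mnorm_expM_ge] and [first_ge]. *)
Lemma displ_double d : exists2 C : R, 0 <= C &
  forall h h' (rho : R), homog_tuple d h -> homog_tuple d h' ->
    tnorm h = 1 -> tnorm h' = 1 -> parallel h' (compt h h) ->
    dnorm h <= rho -> dnorm h' <= rho -> rho <= (2 * n.+1%:R)^-1 ->
    forall i j, mnorm (tnth h ord0 * displ h' i j - 2 *: (tnth h' ord0 * displ h i j))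
      <= C * rho ^+ 2.
Proof.
have [C C0 HC] := displacement_double n.+1 d.
have [c c0 Hc] := mnorm_expM_ge n.+1 d.+1 d.+1 (1 + (d + d.+1)).+1.
set mu : R := (2 * n.+1%:R)^-1.
have mu0 : 0 < mu by rewrite invr_gt0 mulr_gt0 // ltr0n.
exists (C / (c * mu ^+ d.+1)); first by rewrite divr_ge0 // mulr_ge0 ?exprn_ge0 // ltW.
move=> h h' rho hh hh' h1 h'1 par dh dh' rhomu i j.
pose mul0 g : ptup K n := [tuple 'X_ord0 * tnth g i | i < n.+1].
have mul0E g k : tnth (mul0 g) k = tnth g ord0 * 'X_k + displ g ord0 k.
  by rewrite tnth_mktuple /displ; ring.
set Z := _ - _.
have rho01 : 0 <= rho <= 1.
  rewrite (le_trans (dnorm_ge0 h) dh) (le_trans rhomu) // invf_le1 ?mulr_gt0 ?ltr0n //.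
  by rewrite -natrM ler1n.
have key : mnorm (tnth h ord0 ^+ d.+1 * ('X_ord0 * Z)) <= C * rho ^+ 2.
  have parH k l : tnth (mul0 h') k * (tnth (mul0 h) l \mPo (mul0 h)) =
      tnth (mul0 h') l * (tnth (mul0 h) k \mPo (mul0 h)).
    have compH u : tnth (mul0 h) u \mPo (mul0 h) =
        ('X_ord0 * tnth h ord0) * ('X_ord0 ^+ d * tnth (compt h h) u).
      rewrite {1}tnth_mktuple rmorphM /= comp_mpolyXU -tnth_nth {1}tnth_mktuple.
      by rewrite (comp_mpoly_homog _ _ (hh u)) tnth_mktuple.
    rewrite !compH !tnth_mktuple.
    have := par k l; rewrite !tnth_mktuple => E.
    set u := tnth h' k in E *; set v := tnth h' l in E *.
    set U := _ \mPo _ in E *; set V := _ \mPo _ in E *.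
    have -> : 'X_ord0 * u * ('X_ord0 * tnth h ord0 * ('X_ord0 ^+ d * U)) =
      'X_ord0 * ('X_ord0 * tnth h ord0 * ('X_ord0 ^+ d)) * (u * U) by ring.
    rewrite E; ring.
  have := HC _ _ (displ h ord0) (displ h' ord0) _ _ rho (hh ord0)
    (fun k => displ_homog ord0 k hh) (mul0E h) (mul0E h') parH.
  rewrite -{1}h1 -{1}h'1 => /(_ (tnth_le_tnorm _ _) (tnth_le_tnorm _ _) rho01).
  move=> /(_ (fun k => le_trans (displ_le_dnorm _ _ _) dh)
             (fun k => le_trans (displ_le_dnorm _ _ _) dh') i j).
  (* The minors [Q] satisfy [x_i Q_0j - x_j Q_0i = x_0 Q_ij]. *)
  congr (mnorm (_ * _) <= _); rewrite /Z /displ -!mul_mpolyC; ring.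
have hZ : 'X_ord0 * Z \is (1 + (d + d.+1)).-homog for mdeg.
  apply: dhomogM; first exact: mpolyXU_homog.
  by rewrite rpredB ?rpredZ //; apply: dhomogM => //; apply: displ_homog.
have := le_trans (Hc _ _ (dhomog_msize_le (hh ord0)) (dhomog_msize_le hZ)) key.
rewrite mnormXM => low.
rewrite mulrAC ler_pdivlMr ?mulr_gt0 ?exprn_gt0 //; apply: le_trans low.
rewrite mulrC -mulrA ler_pM2l // ler_wpM2r ?mnorm_ge0 //.
rewrite lerXn2r ?nnegrE ?mnorm_ge0 ?(ltW mu0) //.
by apply: first_ge => //; apply: le_trans dh _.
Qed.

(** Intermediate first coordinates are divided out at each step, so only those at the two ends
    remain. Thus only the constant of the quadratic error depends on [J]. *)
Lemma displ_double_iter d J : exists2 C : R, 0 <= C &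
  forall (h : nat -> ptup K n) (rho : R),
    (forall k, homog_tuple d (h k)) -> (forall k, tnorm (h k) = 1) ->
    (forall k, parallel (h k.+1) (compt (h k) (h k))) ->
    (forall k, dnorm (h k) <= rho) -> rho <= (2 * n.+1%:R)^-1 ->
    forall i j, mnorm (tnth (h 0%N) ord0 * displ (h J) i j
                       - 2 ^+ J *: (tnth (h J) ord0 * displ (h 0%N) i j))
      <= C * rho ^+ 2.
Proof.
have [C1 C10 H1] := displ_double d.
have [c c0 Hc] := mnormM_ge n.+1 (d + d.+1).+1.
set mu : R := (2 * n.+1%:R)^-1.
have mu0 : 0 < mu by rewrite invr_gt0 mulr_gt0 // ltr0n.
elim: J => [|J [C2 C20 IH]].
  exists 0 => // h rho _ _ _ _ _ i j.
  by rewrite expr0 scale1r subrr mnorm0 mul0r.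
exists ((C1 + 2 * C2) / (c * mu)).
  by rewrite divr_ge0 ?addr_ge0 ?mulr_ge0 // ltW.
move=> h rho hh h1 par dh rhomu i j.
have a1 k : mnorm (tnth (h k) ord0) <= 1 by rewrite -(h1 k) tnth_le_tnorm.
set Z := _ - _.
(* One doubling step and the induction hypothesis combine after multiplication by the first
   coordinate of [h J]. *)
have E : tnth (h J) ord0 * Z =
    tnth (h 0%N) ord0 * (tnth (h J) ord0 * displ (h J.+1) i j
                         - 2 *: (tnth (h J.+1) ord0 * displ (h J) i j))
    + 2 *: (tnth (h J.+1) ord0 * (tnth (h 0%N) ord0 * displ (h J) i j
                       - 2 ^+ J *: (tnth (h J) ord0 * displ (h 0%N) i j))).
  rewrite /Z exprS -!mul_mpolyC mpolyCM; ring.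
have up : mnorm (tnth (h J) ord0 * Z) <= (C1 + 2 * C2) * rho ^+ 2.
  have -> : (C1 + 2 * C2) * rho ^+ 2 = 1 * (C1 * rho ^+ 2) + 2 * (1 * (C2 * rho ^+ 2)).
    by ring.
  rewrite E; apply: mnormD_le; first by apply: mnormM_le; [exact: a1|exact: H1].
  rewrite mnormZ (nv_nat 2) ler_pM2l //.
  by apply: mnormM_le; [exact: a1|exact: IH].
have hZ : Z \is (d + d.+1).-homog for mdeg.
  by rewrite rpredB ?rpredZ //; apply: dhomogM; [apply: hh|apply: displ_homog|
    apply: hh|apply: displ_homog].
have aD : (msize (tnth (h J) ord0) <= (d + d.+1).+1)%N.
  by rewrite (leq_trans (dhomog_msize_le (hh J ord0))) // ltnS leq_addr.
have := le_trans (Hc _ _ aD (dhomog_msize_le hZ)) up => low.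
rewrite mulrAC ler_pdivlMr ?mulr_gt0 //; apply: le_trans low.
rewrite mulrC -mulrA ler_pM2l // ler_wpM2r ?mnorm_ge0 //.
by apply: first_ge => //; apply: le_trans (dh J) _.
Qed.

(** First [J] is chosen so that [2 ^+ J] beats the fixed loss of dividing by a first coordinate;
    then [eps] is taken small enough for the quadratic error of [J] steps. *)
Lemma dnorm_halve d : exists2 eps : R, 0 < eps &
  forall (h : nat -> ptup K n) (B : R),
    (forall k, homog_tuple d (h k)) -> (forall k, tnorm (h k) = 1) ->
    (forall k, parallel (h k.+1) (compt (h k) (h k))) ->
    (forall k, dnorm (h k) <= B) -> B <= eps -> dnorm (h 0%N) <= B / 2.
Proof.
have cancel_x (c mu N w : R) : 0 < c -> 0 < mu ->
    4 * N / (c * mu) * (c * (mu * w)) = 2 * (w * (2 * N)).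
  by move=> c0 mu0; field; rewrite !gt_eqF.
have cancel_N (N B : R) : 0 < N -> N * (B / (2 * N)) = B / 2.
  by move=> N0; field; rewrite gt_eqF.
have [c c0 Hc] := mnormM_ge n.+1 d.+2.
set mu : R := (2 * n.+1%:R)^-1.
have mu0 : 0 < mu by rewrite invr_gt0 mulr_gt0 // ltr0n.
set N := (n.+1%:R * n.+1%:R : R).
have N0 : 0 < N by rewrite mulr_gt0 // ltr0n.
(* With this [x], the bound [x * (c * (mu * w)) <= 2 * B] says [w <= B / (2 * N)], and the [N]
   entries add up to [B / 2]. *)
pose x := 4 * N / (c * mu).
pose J := Num.bound x.
have xJ : x < 2 ^+ J by apply: upper_nthrootP.
have [C C0 HC] := displ_double_iter d J.
(* The bound [mu] serves [first_ge]; the other one gives [C * B ^+ 2 <= B]. *)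
exists (Num.min mu (C + 1)^-1).
  by rewrite lt_min mu0 invr_gt0 ltr_wpDl.
move=> h B hh h1 par dh; rewrite le_min => /andP[Bmu BC].
have B0 : 0 <= B := le_trans (dnorm_ge0 _) (dh 0%N).
have a1 k : mnorm (tnth (h k) ord0) <= 1 by rewrite -(h1 k) tnth_le_tnorm.
have CB : C * B ^+ 2 <= B.
  have : (C + 1) * B <= 1.
    by rewrite mulrC -ler_pdivlMr ?div1r // ltr_wpDl.
  rewrite expr2 mulrA => h2; rewrite ler_piMl //.
  by apply: le_trans h2; rewrite ler_wpM2r // lerDl.
have entry i j : mnorm (displ (h 0%N) i j) <= B / (2 * N).
  have up : 2 ^+ J * mnorm (tnth (h J) ord0 * displ (h 0%N) i j) <= 2 * B.
    have <- : nv (2 ^+ J) = 2 ^+ J by rewrite -natrX nv_nat natrX.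
    rewrite -mnormZ.
    set u := _ *: _; set v := tnth (h 0%N) ord0 * displ (h J) i j.
    have -> : u = v - (v - u) by rewrite opprB addrC subrK.
    apply: le_trans (mnormB _ _) _; rewrite mulr_natl mulr2n lerD //.
      rewrite -[X in _ <= X]mul1r; apply: mnormM_le => //.
      exact: le_trans (displ_le_dnorm _ _ _) (dh J).
    exact: le_trans (HC _ _ hh h1 par dh Bmu i j) CB.
  have low : c * (mu * mnorm (displ (h 0%N) i j)) <=
      mnorm (tnth (h J) ord0 * displ (h 0%N) i j).
    apply: le_trans (Hc _ _ _ _).
    - rewrite ler_pM2l // ler_wpM2r ?mnorm_ge0 //.
      by apply: first_ge => //; apply: le_trans (dh J) _.
    - by apply/leqW/dhomog_msize_le; apply: hh.
    - by apply: dhomog_msize_le; apply: displ_homog.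
  set w := mnorm (displ _ _ _) in low *.
  have w0 : 0 <= w by apply: mnorm_ge0.
  have h2 : x * (c * (mu * w)) <= 2 * B.
    apply: le_trans up; apply: ler_pM => //; last exact: ltW.
    - by rewrite /x divr_ge0 ?mulr_ge0 // ltW.
    - by rewrite !mulr_ge0 // ltW.
  rewrite ler_pdivlMr ?mulr_gt0 //.
  by move: h2; rewrite cancel_x // ler_pM2l.
rewrite /dnorm.
apply: (@le_trans _ _ (\sum_(i < n.+1) \sum_(j < n.+1) (B / (2 * N)))).
  by apply: ler_sum => i _; apply: ler_sum => j _.
by rewrite !sumr_const card_ord -mulrnA -[X in X <= _]mulr_natl natrM cancel_N.
Qed.

(** * Subgroups of small displacement *)

Lemma tnorm_ge0 h : 0 <= tnorm h.
Proof. by apply: sumr_ge0 => i _; apply: mnorm_ge0. Qed.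

Lemma tnorm_gt0 h : nonzero_tuple h -> 0 < tnorm h.
Proof.
case=> i hi; apply: lt_le_trans (tnth_le_tnorm h i).
rewrite lt_neqAle mnorm_ge0 andbT eq_sym.
by apply: contraNneq hi => /mnorm_eq0 ->.
Qed.

Lemma same_map_refl h : ratmap h -> same_map h h.
Proof. by move=> rh; split=> // i j; rewrite mulrC. Qed.

Lemma same_map_sym h g : same_map h g -> same_map g h.
Proof. by case=> rh rg p; split=> // i j; rewrite mulrC p mulrC. Qed.

Lemma parallel_trans g h k : nonzero_tuple g -> parallel h g -> parallel g k -> parallel h k.
Proof.
move=> [l gl] hg gk i j; apply: (mulfI gl).
have -> : tnth g l * (tnth h i * tnth k j) = tnth h i * (tnth g l * tnth k j) by ring.
rewrite gk mulrA hg -mulrA gk; ring.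
Qed.

Lemma same_map_trans g h k : same_map h g -> same_map g k -> same_map h k.
Proof.
case=> rh [d [_ g0]] hg [_ rk gk]; split=> //.
exact: parallel_trans g0 hg gk.
Qed.

Lemma tnth_scalet c h i : tnth (scalet c h) i = c *: tnth h i.
Proof. by rewrite tnth_map. Qed.

Lemma in_W_scalet d c h : c != 0 -> in_W d h -> in_W d (scalet c h).
Proof.
move=> c0 [hh [i hi]]; split; first by move=> j; rewrite tnth_scalet rpredZ ?hh.
by exists i; rewrite tnth_scalet scaler_eq0 negb_or c0.
Qed.

Lemma ratmap_scalet c h : c != 0 -> ratmap h -> ratmap (scalet c h).
Proof. by move=> c0 [d hd]; exists d; apply: in_W_scalet. Qed.

Lemma same_map_scalet c h g : c != 0 -> same_map h g -> same_map (scalet c h) g.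
Proof.
move=> c0 [rh rg hg]; split=> //; first exact: ratmap_scalet.
by move=> i j; rewrite !tnth_scalet -!scalerAl hg.
Qed.

Lemma compt_scaletl c h g : compt (scalet c h) g = scalet c (compt h g).
Proof.
by apply: eq_from_tnth => i; rewrite tnth_scalet !tnth_mktuple tnth_scalet comp_mpolyZ.
Qed.

Lemma compt_scaletr d c h g : homog_tuple d h ->
  compt h (scalet c g) = scalet (c ^+ d) (compt h g).
Proof.
move=> hh; apply: eq_from_tnth => i; rewrite tnth_scalet !tnth_mktuple.
rewrite -mul_mpolyC rmorphXn /= -(comp_mpoly_homog _ _ (hh i)); congr (_ \mPo _).
by apply: eq_from_tnth => j; rewrite tnth_scalet tnth_mktuple mul_mpolyC.
Qed.

Lemma birational_scalet c h : c != 0 -> birational h -> birational (scalet c h).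
Proof.
move=> c0 [rh [g [rg hg gh]]]; split; first exact: ratmap_scalet.
exists g; split; first exact: rg.
  by rewrite compt_scaletl; exact: same_map_scalet c0 hg.
case: (rg) => d [hd _]; rewrite (compt_scaletr _ _ hd).
exact: same_map_scalet (expf_neq0 d c0) gh.
Qed.

Lemma tnorm_scalet c h : tnorm (scalet c h) = nv c * tnorm h.
Proof. by rewrite /tnorm mulr_sumr; apply: eq_bigr => i _; rewrite tnth_scalet mnormZ. Qed.

Lemma in_W_idt : in_W 1 (idt K n).
Proof.
split; last by exists ord0; rewrite tnth_mktuple -msize_poly_eq0 msizeX.
by move=> i; rewrite tnth_mktuple mpolyXU_homog.
Qed.

Lemma ratmap_idt : ratmap (idt K n).
Proof. by exists 1%N; exact: in_W_idt. Qed.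

Lemma dnorm0_same_map h : ratmap h -> dnorm h = 0 -> same_map h (idt K n).
Proof.
move=> rh h0; split=> //; first exact: ratmap_idt.
move=> i j; have /mnorm_eq0/eqP : mnorm (displ h i j) = 0.
  by apply/eqP; rewrite eq_le mnorm_ge0 andbT -h0 displ_le_dnorm.
rewrite /displ subr_eq0 => /eqP E.
by rewrite !tnth_mktuple mulrC -E mulrC.
Qed.

(** Representatives may have a common factor, so one of degree exactly [d] encodes degree at most
    [d]. *)
Definition degree_le d h : Prop := exists2 h', in_H d h' & same_map h h'.

Lemma small_subgroup_trivial d : exists2 eps : R, 0 < eps &
  forall G : ptup K n -> Prop, subgroupBir G -> (forall h, G h -> degree_le d h) ->
    (forall h, G h -> in_W d h -> dnorm h <= eps * tnorm h) ->
    forall h, G h -> same_map h (idt K n).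
Proof.
have [eps eps0 halve] := dnorm_halve d.
exists eps => // G [[Gbir Gsat] _ Gmul _] Gdeg Gsmall.
pose S h := [/\ G h, in_W d h & tnorm h = 1].
have rep h : G h -> exists2 h', S h' & same_map h h'.
  move=> Gh; have [h' [Wh' bh'] hh'] := Gdeg h Gh.
  have Nh' := tnorm_gt0 Wh'.2; set c := emb (tnorm h')^-1.
  have c0 : c != 0 by rewrite fmorph_eq0 invr_eq0 gt_eqF.
  have same : same_map h (scalet c h').
    by apply/same_map_sym/same_map_scalet => //; apply: same_map_sym.
  exists (scalet c h') => //; split.
  - exact: Gsat h _ Gh (birational_scalet c0 bh') same.
  - exact: in_W_scalet.
  - by rewrite tnorm_scalet nv_emb ?mulVf ?gt_eqF // invr_ge0 ltW.
(* The tuple [compt h h] has degree [d ^ 2]; the degree bound on the group provides a normalised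
   representative of the square in degree [d] again. *)
have step h : exists h', S h -> S h' /\ parallel h' (compt h h).
  have [Sh|nSh] := pselect (S h); last by exists h.
  have [Gh _ _] := Sh; have [h' Sh' [_ _ hh']] := rep _ (Gmul _ _ Gh Gh).
  by exists h' => _; split=> // i j; rewrite mulrC hh' mulrC.
have [f fP] := choice step.
(* The bound is proved for all of [S] at once, since halving it at one element uses it along all the
   iterated squares. *)
have shrink k h : S h -> dnorm h <= eps / 2 ^+ k.
  elim: k h => [|k IH] h Sh.
    rewrite expr0 divr1; have [Gh Wh h1] := Sh.
    by have := Gsmall h Gh Wh; rewrite h1 mulr1.
  have Sit i : S (iter i f h) by elim: i => //= i IHi; case: (fP _ IHi).
  have -> : eps / 2 ^+ k.+1 = eps / 2 ^+ k / 2 by rewrite exprSr invfM mulrA.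
  apply: (halve (fun i => iter i f h)) => [i|i|i|i|]; do ?by case: (Sit i) => _ [].
  - by case: (fP _ (Sit i)).
  - exact: IH.
  - by rewrite ler_pdivrMr ?exprn_gt0 // ler_peMr ?exprn_ege1 ?(ltW eps0) //; lra.
move=> h Gh; have [h' Sh' hh'] := rep h Gh.
have [_ Wh' _] := Sh'; apply: same_map_trans hh' _.
apply: dnorm0_same_map; first by exists d.
apply/eqP; rewrite eq_le dnorm_ge0 andbT leNgt; apply/negP => pos.
have /shrink := Sh' => /(_ (Num.bound (eps / dnorm h'))).
rewrite ler_pdivlMr ?exprn_gt0 // mulrC -ler_pdivlMr // leNgt => /negP; apply.
exact: upper_nthrootP.
Qed.

(** * Neighbourhoods of the identity *)

Definition near d h (P : ptup K n -> Prop) : Prop := exists2 e : R, 0 < e &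
  forall h', in_W d h' -> (forall i, mnorm (tnth h' i - tnth h i) <= e) -> P h'.

(** [N] exceeds the number of exponents of degree at most [d], so coefficients within [e / N] give
    norms within [e]. *)
Lemma near_close d h P : in_W d h -> near d h P ->
  exists2 eps : K, 0 < eps & forall h', in_W d h' -> close eps h h' -> P h'.
Proof.
move=> [hh _] [e e0 HP]; set N := #|{: 'X_{1..n.+1 < d.+1}}|%:R + 1 : R.
have N0 : 0 < N by rewrite ltr_wpDl.
exists (emb (e / N)); first by rewrite -(rmorph0 emb) emb_lt divr_gt0.
move=> h' [hh' h'0] cl; apply: HP => // i.
have hom : tnth h' i - tnth h i \is d.-homog for mdeg by rewrite rpredB ?hh ?hh'.
apply: le_trans (mnorm_le_coef (e := e / N) (dhomog_msize_le hom) _) _.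
  move=> m; have := cl i m; rewrite normE emb_lt => /ltW.
  by rewrite mcoeffB -nvN opprB.
rewrite mulrA ler_pdivrMr // mulrC ler_pM2l // /N; lra.
Qed.

Lemma near_forall d h N (P : nat -> ptup K n -> Prop) :
  (forall k, (k < N)%N -> near d h (P k)) ->
  near d h (fun h' => forall k, (k < N)%N -> P k h').
Proof.
elim: N => [|N IH] HP; first by exists 1.
have [e1 e10 H1] := IH (fun k kN => HP k (ltnW kN)).
have [e2 e20 H2] := HP N (ltnSn N).
exists (Num.min e1 e2); first by rewrite lt_min e10.
move=> h' Wh' hh' k; rewrite ltnS leq_eqVlt => /predU1P[->|kN].
  by apply: H2 => // i; apply: le_trans (hh' i) _; rewrite ge_min lexx orbT.
by apply: H1 => // i; apply: le_trans (hh' i) _; rewrite ge_min lexx.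
Qed.

(** A non-zero minor of [h] and [g] stays non-zero nearby; this makes single maps closed in each
    degree. *)
Lemma near_not_parallel d h g : ~ parallel h g -> near d h (fun h' => ~ parallel h' g).
Proof.
move=> nhg.
have [i [j nij]] : exists i j, tnth h i * tnth g j != tnth h j * tnth g i.
  apply: contrapT => none; apply: nhg => i j; apply/eqP; apply: contrapT => /negP nij.
  by apply: none; exists i, j.
set del := mnorm (tnth h i * tnth g j - tnth h j * tnth g i).
have del0 : 0 < del.
  rewrite lt_neqAle mnorm_ge0 andbT eq_sym; apply: contraNneq nij => /mnorm_eq0/eqP.
  by rewrite subr_eq0.
set T := 2 * (tnorm g + 1).
have T0 : 0 < T by have := tnorm_ge0 g; rewrite /T; lra.
exists (del / T) => [|h' _ hh' par]; first by rewrite divr_gt0.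
have : del <= del / T * tnorm g + del / T * tnorm g.
  have E : tnth h i * tnth g j - tnth h j * tnth g i =
      (tnth h' j - tnth h j) * tnth g i - (tnth h' i - tnth h i) * tnth g j.
    by rewrite !mulrBl (par i j); ring.
  by rewrite {1}/del E; apply: mnormB_le; apply: mnormM_le;
    do ?[exact: hh' | exact: tnth_le_tnorm].
apply/negP; rewrite -ltNge -mulrDr mulrAC ltr_pdivrMr // ltr_pM2l // /T; lra.
Qed.

Definition mulp (c : {mpoly K[n.+1]}) h : ptup K n := [tuple c * tnth h i | i < n.+1].

Lemma in_W_mulp d e c h : c \is e.-homog for mdeg -> c != 0 -> in_W d h ->
  in_W (e + d) (mulp c h).
Proof.
move=> hc c0 [hh [i hi]]; split; last by exists i; rewrite tnth_mktuple mulf_neq0.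
by move=> j; rewrite tnth_mktuple; apply: dhomogM; rewrite ?hh.
Qed.

Lemma same_map_mulp e c h g : c \is e.-homog for mdeg -> c != 0 -> same_map h g ->
  same_map (mulp c h) g.
Proof.
move=> hc c0 [[d Wh] rg hg]; split; [by exists (e + d)%N; apply: in_W_mulp | by [] |].
by move=> i j; rewrite !tnth_mktuple -!mulrA hg.
Qed.

(** Multiply the representative by [x_0]; the same [g] remains an inverse. *)
Lemma degree_leS d h : degree_le d h -> degree_le d.+1 h.
Proof.
move=> [h' [Wh' [rh' [g [rg hg gh]]]] hh'].
have hX := mpolyXU_homog ord0.
have X0 : ('X_ord0 : {mpoly K[n.+1]}) != 0 by rewrite -msize_poly_eq0 msizeX.
have Wm := in_W_mulp hX X0 Wh'.
have [e [hge _]] := rg.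
(* Otherwise [g o h'] would map into the hyperplane [x_0 = 0] and could not be the identity. *)
have g0 : tnth g ord0 != 0.
  apply/eqP => g0; have [[e' [_ [i gi]]] _ /(_ i ord0)] := gh.
  rewrite !tnth_mktuple g0 raddf0 mul0r; apply/eqP; rewrite mulf_neq0 //.
  by move: gi; rewrite tnth_mktuple.
exists (mulp 'X_ord0 h'); last first.
  apply: same_map_sym; apply: (same_map_mulp hX X0); exact: same_map_sym.
split=> //; split; first by exists d.+1.
exists g; split; first exact: rg.
  have -> : compt (mulp 'X_ord0 h') g = mulp (tnth g ord0) (compt h' g).
    apply: eq_from_tnth => i; rewrite !tnth_mktuple rmorphM /=.
    by rewrite comp_mpolyXU -tnth_nth.
  exact: same_map_mulp (hge ord0) g0 hg.
have -> : compt g (mulp 'X_ord0 h') = mulp ('X_ord0 ^+ e) (compt g h').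
  by apply: eq_from_tnth => i; rewrite !tnth_mktuple (comp_mpoly_homog _ _ (hge i)).
apply: (@same_map_mulp (1 * e)); last exact: gh.
  exact: dhomogMn.
exact: expf_neq0.
Qed.

Lemma degree_le_leq d e h : (d <= e)%N -> degree_le d h -> degree_le e h.
Proof. by move=> /subnK <-; elim: (e - d)%N => //= k IH /IH /degree_leS. Qed.

Lemma birational_idt : birational (idt K n).
Proof.
have E : compt (idt K n) (idt K n) = idt K n.
  by apply: eq_from_tnth => i; rewrite tnth_mktuple comp_mpoly_id.
split; first exact: ratmap_idt.
exists (idt K n); rewrite E; split; [exact: ratmap_idt | | ];
  exact: same_map_refl ratmap_idt.
Qed.

Lemma in_H_idt : in_H 1 (idt K n).
Proof. by split; [exact: in_W_idt | exact: birational_idt]. Qed.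

(* Elements of unbounded degree, one for each [k], meet every [Bir_{<=d}] in a
   finite set, so their complement is an open neighbourhood of the identity. *)
Lemma cvg_degree_bounded (G : nat -> ptup K n -> Prop) :
  (forall m, subgroupBir (G m)) -> cvg_to_id G ->
  exists d m0, forall m, (m0 < m)%N -> forall h, G m h -> degree_le d h.
Proof.
move=> Ggrp Gcvg; apply: contrapT => unb.
(* Degree above [k + 1], rather than above [k], ensures that [u 0] is not the identity either. *)
have pick k : exists h, (exists2 m, (k < m)%N & G m h) /\ ~ degree_le k.+1 h.
  apply: contrapT => none; apply: unb; exists k.+1, k => m km h Gh.
  by apply: contrapT => ndeg; apply: none; exists h; split=> //; exists m.
have [u uP] := choice pick.
have u_bir k : birational (u k).
  by have [[m _ Gu] _] := uP k; have [[Gbir _] _ _ _] := Ggrp m; apply: Gbir.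
pose U h := birational h /\ forall k, ~ same_map h (u k).
have Uopen : openBir U.
  split.
    split=> [h []//|h h' [_ hu] bh' hh']; split=> // k h'u.
    exact/(hu k)/(same_map_trans hh').
  (* Elements of degree at most [d] differ from [u k] for [k >= d] by degree alone, so finitely many
     conditions remain. *)
  move=> d d1; exists (fun h => forall k, (k < d)%N -> ~ parallel h (u k)); split.
    split=> [c h _ c0 Vh k kd par|h Wh Vh].
      apply: (Vh k kd) => i j; have := par i j.
      by rewrite !tnth_scalet -!scalerAl; apply: scalerI.
    apply: near_close => //; apply: near_forall => k kd.
    exact/near_not_parallel/Vh.
  move=> h [Wh bh]; split=> [[_ hu] k kd par|Vh].
    by apply: (hu k); split; [by exists d | by case: (u_bir k) | exact: par].
  split=> // k hu; have [kd|dk] := ltnP k d; first by apply: (Vh k kd); case: hu.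
  case: (uP k) => _; apply; apply: (degree_le_leq (leqW dk)).
  by exists h => //; apply: same_map_sym.
have Uid : U (idt K n).
  split; first exact: birational_idt.
  move=> k /same_map_sym idu; case: (uP k) => _; apply.
  by apply: (@degree_le_leq 1) => //; exists (idt K n) => //; exact: in_H_idt.
have [m0 HU] := Gcvg U Uopen Uid.
have [[m m0m Gu] _] := uP m0.
by have [_ /(_ m0)] := HU m m0m _ Gu; apply; apply: same_map_refl; case: (u_bir m0).
Qed.

(** * Points almost fixed by a map *)

Lemma nonzero_at_some_point (q : {mpoly K[n.+1]}) : q != 0 -> exists z, q.@[z] != 0.
Proof.
move=> q0; apply: contrapT => none; case/eqP: q0; apply: mnorm_eq0.
have [s /(_ s)[C C0 HC]] := kronecker_interpolation n.+1 (msize q).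
apply/eqP; rewrite eq_le mnorm_ge0 andbT -(mulr0 C).
apply: (HC q (iota 0 s)); rewrite ?iota_uniq ?size_iota //.
  by move=> t; rewrite mem_iota => /andP[_ /ltnW].
move=> t _; rewrite (_ : q.@[_] = 0) ?nv0 //; apply/eqP; apply: contrapT => /negP nz.
by apply: none; exists (kronecker_point (msize q) t).
Qed.

(** On the line from [x] to a point [z] with [q(z) != 0], the polynomial [q] has finitely many
    zeros, so some small parameter avoids them. *)
Lemma nonzero_dense (q : {mpoly K[n.+1]}) (x : 'I_n.+1 -> K) (delta : R) :
  q != 0 -> 0 < delta -> exists2 y, forall i, nv (y i - x i) <= delta & q.@[y] != 0.
Proof.
move=> q0 del0; have [z qz] := nonzero_at_some_point q0.
pose P : {poly K} := mmap polyC (fun i => (x i)%:P + 'X * (z i - x i)%:P) q.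
have PE s : P.[s] = q.@[fun i => x i + s * (z i - x i)].
  rewrite /P /mmap horner_sum mevalE; apply: eq_bigr => m _.
  rewrite hornerM hornerC /mmap1 horner_prod; congr (_ * _).
  by apply: eq_bigr => i _; rewrite horner_exp !hornerE.
have P0 : P != 0.
  apply: contraNneq qz => P0; have := PE 1; rewrite P0 horner0 => E.
  by apply/eqP; rewrite -[LHS]/(q.@[z]) {}E; apply: meval_eq => i; rewrite mul1r addrC subrK.
pose Z : R := \sum_i nv (z i - x i).
have Z0 : 0 <= Z by apply: sumr_ge0 => i _; apply: nv_ge0.
pose N := Num.bound (Z / delta).
have NP : Z / delta < N%:R by apply: archi_boundP; rewrite divr_ge0 // ltW.
(* These are [size P] distinct parameters, more than [P] has roots; [N] makes each displacement at
   most [delta]. *)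
pose rs : seq K := [seq (N + j.+1)%:R^-1 | j <- iota 0 (size P)].
have urs : uniq rs.
  rewrite map_inj_uniq ?iota_uniq // => a b /invr_inj/eqP.
  by rewrite eqr_nat eqn_add2l eqSS => /eqP.
have /allPn[s /mapP[j _ ->] nr] : ~~ all (root P) rs.
  apply/negP => ar; have := max_poly_roots P0 ar urs.
  by rewrite size_map size_iota ltnn.
exists (fun i => x i + (N + j.+1)%:R^-1 * (z i - x i)); last by rewrite -PE.
move=> i; rewrite addrC addKr nvM.
have Nj : 0 < (N + j.+1)%:R :> R by rewrite ltr0n addnS.
have -> : nv (N + j.+1)%:R^-1 = (N + j.+1)%:R^-1.
  have -> : (N + j.+1)%:R^-1 = emb (N + j.+1)%:R^-1 :> K by rewrite fmorphV rmorph_nat.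
  by rewrite nv_emb // invr_ge0 ltW.
rewrite mulrC ler_pdivrMr //.
have zi : nv (z i - x i) <= Z.
  by rewrite /Z (bigD1 i) //= lerDl sumr_ge0 // => *; apply: nv_ge0.
apply: le_trans zi _; rewrite mulrC -ler_pdivrMr //; apply: le_trans (ltW NP) _.
by rewrite ler_nat leq_addr.
Qed.

(* A scale-invariant way to say that [g] is defined at [x] and moves it by less
   than [eps]: the strict inequality forces [g_k(x) <> 0]. *)
Definition fixes_upto (eps : R) g (x : 'I_n.+1 -> K) : Prop := exists k,
  \sum_i \sum_j nv (displ g i j).@[x] < eps * nv (tnth g k).@[x].

Lemma fixes_upto_perturb eps g x : 0 < eps -> fixes_upto eps g x ->
  exists2 tau : R, 0 < tau & forall g' x',
    (forall i j, nv ((displ g' i j).@[x'] - (displ g i j).@[x]) <= tau) ->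
    (forall k, nv ((tnth g' k).@[x'] - (tnth g k).@[x]) <= tau) -> fixes_upto eps g' x'.
Proof.
move=> eps0 [k lt_k]; set F := \sum_i _ in lt_k; set v := nv _ in lt_k.
set N : R := n.+1%:R * n.+1%:R.
have N0 : 0 <= N by rewrite mulr_ge0.
(* Perturbing by [tau] costs [N * tau] on the left and [eps * tau] on the right; the extra 1 keeps
   the inequality strict. *)
pose T := N + eps + 1.
have T0 : 0 < T by rewrite /T; lra.
exists ((eps * v - F) / T); first by rewrite divr_gt0 // subr_gt0.
set tau := _ / _ => g' x' Hd Hk; exists k.
have tauT : tau * T = eps * v - F by rewrite /tau divfK // gt_eqF.
have tau0 : 0 < tau by rewrite divr_gt0 // subr_gt0.
have nvDB (a b : K) : nv a <= nv b + nv (a - b) by rewrite -{1}(subrK b a) addrC nvD.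
have upF : \sum_i \sum_j nv (displ g' i j).@[x'] <= F + tau * N.
  have -> : tau * N = \sum_(i < n.+1) \sum_(j < n.+1) tau.
    by rewrite !sumr_const card_ord -mulrnA -[RHS]mulr_natr natrM.
  rewrite /F -big_split /=; apply: ler_sum => i _.
  rewrite -big_split /=; apply: ler_sum => j _.
  by apply: le_trans (nvDB _ (displ g i j).@[x]) _; rewrite lerD2l Hd.
have lowk : v - tau <= nv (tnth g' k).@[x'].
  have := nvDB (tnth g k).@[x] (tnth g' k).@[x'].
  have := Hk k; rewrite -nvN opprB -/v; lra.
apply: le_lt_trans upF _; apply: lt_le_trans (_ : eps * (v - tau) <= _); last first.
  by rewrite ler_pM2l.
have : tau * T = tau * N + tau * eps + tau by rewrite /T; ring.
rewrite tauT mulrBr (mulrC eps tau); move: (tau * N) (tau * eps) (eps * v) => a b c; lra.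
Qed.

Lemma fixes_upto_continuous d eps g x : 0 < eps -> homog_tuple d g -> fixes_upto eps g x ->
  exists2 delta : R, 0 < delta & forall y, (forall i, nv (y i - x i) <= delta) ->
    fixes_upto eps g y.
Proof.
move=> eps0 hg /(fixes_upto_perturb eps0)[tau tau0 Htau].
pose M : R := \sum_i nv (x i) + 1.
have xM i : nv (x i) <= M - 1.
  by rewrite /M addrK (bigD1 i) //= lerDl sumr_ge0 // => *; apply: nv_ge0.
have M1 : 1 <= M by rewrite /M lerDr sumr_ge0 // => *; apply: nv_ge0.
pose A := tnorm g + dnorm g.
have A0 : 0 <= A by rewrite addr_ge0 ?tnorm_ge0 ?dnorm_ge0.
pose L := A * (d.+1%:R * M ^+ d.+1) + 1.
have L0 : 0 < L by rewrite ltr_wpDl // !mulr_ge0 // exprn_ge0 //; lra.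
(* The cap 1 keeps [y] within the bound [M], where [L] is valid. *)
exists (Num.min 1 (tau / L)); first by rewrite lt_min ltr01 divr_gt0.
set delta := Num.min _ _ => y xy.
have del1 : delta <= 1 by rewrite ge_min lexx.
have delL : delta <= tau / L by rewrite ge_min lexx orbT.
have del0 : 0 <= delta by rewrite le_min ler01 divr_ge0 // ltW.
have yM i : nv (y i) <= M.
  have := nvD (y i - x i) (x i); rewrite subrK.
  have := xy i; have := xM i; lra.
have lip q : (msize q <= d.+2)%N -> mnorm q <= A -> nv (q.@[y] - q.@[x]) <= tau.
  move=> qd qA; apply: le_trans (meval_lipschitz (M := M) _ del0 yM _ xy qd) _ => //.
    by move=> i; apply: le_trans (xM i) _; lra.
  apply: (@le_trans _ _ (A * (d.+1%:R * M ^+ d.+1 * delta))).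
    by rewrite ler_wpM2r // !mulr_ge0 // exprn_ge0 //; lra.
  apply: (@le_trans _ _ (L * delta)).
    by rewrite mulrA ler_wpM2r // /L lerDl.
  by rewrite mulrC -ler_pdivlMr.
apply: Htau => [i j|k]; apply: lip.
- exact/dhomog_msize_le/displ_homog.
- by apply: le_trans (displ_le_dnorm g i j) _; rewrite lerDr tnorm_ge0.
- exact/leqW/dhomog_msize_le.
- by apply: le_trans (tnth_le_tnorm g k) _; rewrite lerDl dnorm_ge0.
Qed.

Lemma near_fixes_upto d eps h x : 0 < eps -> homog_tuple d h -> fixes_upto eps h x ->
  near d h (fun h' => fixes_upto eps h' x).
Proof.
move=> eps0 hh /(fixes_upto_perturb eps0)[tau tau0 Htau].
pose M : R := \sum_i nv (x i) + 1.
have xM i : nv (x i) <= M.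
  apply: (@le_trans _ _ (\sum_i nv (x i))); last by rewrite lerDl.
  by rewrite (bigD1 i) //= lerDl sumr_ge0 // => *; apply: nv_ge0.
have M1 : 1 <= M by rewrite /M lerDr sumr_ge0 // => *; apply: nv_ge0.
have M0 : 0 < M by lra.
have Md0 : 0 < 2 * M ^+ d.+1 by rewrite mulr_gt0 // exprn_gt0.
exists (tau / (2 * M ^+ d.+1)); first by rewrite divr_gt0.
set e := _ / _ => h' [hh' _] he.
have e0 : 0 <= e by rewrite divr_ge0 // ltW.
have eM : 2 * e * M ^+ d.+1 = tau by rewrite mulrAC /e mulrC divfK // gt_eqF.
apply: Htau => [i j|k]; rewrite -mevalB.
  apply: le_trans (meval_bound (M := M) (e := d.+1) M1 xM _) _.
    by apply: dhomog_msize_le; rewrite rpredB //; apply: displ_homog.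
  rewrite -eM ler_wpM2r ?exprn_ge0 ?(ltW M0) //.
  have -> : displ h' i j - displ h i j =
      'X_i * (tnth h' j - tnth h j) - 'X_j * (tnth h' i - tnth h i).
    by rewrite /displ; ring.
  by rewrite mulr_natl mulr2n; apply: mnormB_le; rewrite mnormXM.
apply: le_trans (meval_bound (M := M) (e := d.+1) M1 xM _) _.
  by apply/leqW/dhomog_msize_le; rewrite rpredB ?hh ?hh'.
rewrite -eM ler_wpM2r ?exprn_ge0 ?(ltW M0) //.
by apply: le_trans (he k) _; lra.
Qed.

(** Where neither tuple vanishes, the values of parallel tuples are proportional, and the condition
    is homogeneous in these values. *)
Lemma fixes_upto_parallel eps g h x l : parallel g h -> 0 < eps -> fixes_upto eps g x ->
  (tnth h l).@[x] != 0 -> fixes_upto eps h x.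
Proof.
move=> par eps0 [k lt_k] hl; exists k.
have par' i j : (tnth g i).@[x] * (tnth h j).@[x] = (tnth g j).@[x] * (tnth h i).@[x].
  by rewrite -!mevalM par.
have gk : 0 < nv (tnth g k).@[x].
  rewrite -(pmulr_rgt0 _ eps0); apply: le_lt_trans lt_k.
  by rewrite sumr_ge0 // => i _; rewrite sumr_ge0 // => j _; apply: nv_ge0.
have hk : 0 < nv (tnth h k).@[x].
  apply: nv_gt0; apply: contraNneq hl => hk.
  have /eqP := par' k l; rewrite hk mulr0 mulf_eq0 => /orP[/eqP g0|//].
  by move: gk; rewrite g0 nv0 ltxx.
have E i j : nv (displ h i j).@[x] * nv (tnth g k).@[x] =
    nv (tnth h k).@[x] * nv (displ g i j).@[x].
  rewrite -!nvM; congr nv; rewrite /displ !mevalB !mevalM !mevalXU.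
  have := par' k j; have := par' k i; rewrite mulrC => Ei; rewrite mulrC => Ej.
  rewrite mulrBl -!mulrA Ej Ei; ring.
rewrite -(ltr_pM2r gk) mulr_suml.
under eq_bigr do rewrite mulr_suml.
under eq_bigr do under eq_bigr do rewrite E.
under eq_bigr do rewrite -mulr_sumr.
by rewrite -mulr_sumr mulrAC mulrC ltr_pM2r.
Qed.

(** Asking for some point of an open ball, not its centre, makes the condition independent of the
    representative, which may vanish at a given point. *)
Definition fixes_near eps eta y h : Prop :=
  exists2 x, forall i, nv (x i - y i) < eta & fixes_upto eps h x.

Lemma fixes_near_same_map eps eta y g h : 0 < eps -> same_map g h ->
  fixes_near eps eta y g -> fixes_near eps eta y h.
Proof.
move=> eps0 [[d [hg _]] [d' [_ [l hl]]] par] [x xy fx].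
have [delta del0 Hdel] := fixes_upto_continuous eps0 hg fx.
(* The point [x] can move by this much within the ball while [g] still almost fixes it; this leaves
   room to avoid the zeros of [h_l]. *)
have slack : 0 < \big[Num.min/delta]_i (eta - nv (x i - y i)).
  by elim/big_rec: _ => // i z _ z0; rewrite lt_min z0 subr_gt0 xy.
set sl := \big[_/_]_i _ in slack.
have sl_le i : sl <= eta - nv (x i - y i) by apply: bigmin_le_cond.
have sl_del : sl <= delta by apply: bigmin_le_id.
have sl2 : 0 < sl / 2 by rewrite divr_gt0.
have [z zx hz] := nonzero_dense x hl sl2.
exists z => [i|].
  have := nvD (z i - x i) (x i - y i); rewrite addrA subrK.
  have := zx i; have := sl_le i; lra.
apply: (fixes_upto_parallel par eps0 _ hz); apply: Hdel => i.
by apply: le_trans (zx i) _; lra.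
Qed.

(** Each minor is small at the almost fixed points, hence at the nearby Kronecker points up to an
    error proportional to its own norm [w] and to [eta]. Interpolation bounds [w] by these values,
    and a small [eta] lets the error be absorbed. *)
Lemma fixes_near_bound d : exists s : nat, exists2 eta : R, 0 < eta &
  exists2 C : R, 0 < C & forall (eps : R) h, 0 < eps -> in_W d h ->
    (forall t, (t < s)%N -> fixes_near eps eta (kronecker_point d.+2 t.+1) h) ->
    dnorm h <= C * eps * tnorm h.
Proof.
have [s /(_ s)[C0 C00 HC]] := kronecker_interpolation n.+1 d.+2.
have [B B1 HB] := kronecker_point_bound n.+1 d.+2 s.
pose M := B + 1; have M1 : 1 <= M by rewrite /M; lra.
have M0 : 0 < M by lra.
pose L := d.+1%:R * M ^+ d.+1.
have L0 : 0 < L by rewrite mulr_gt0 ?ltr0n ?exprn_gt0.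
(* The second bound makes the error term at most [w / 2]; the first keeps the points within [M]. *)
pose eta := Num.min 1 (2 * C0 * L)^-1.
have CL0 : 0 < 2 * C0 * L by rewrite mulr_gt0 // mulr_gt0.
have eta0 : 0 < eta by rewrite lt_min ltr01 invr_gt0.
pose N : R := n.+1%:R * n.+1%:R.
have N0 : 0 < N by rewrite mulr_gt0 // ltr0n.
exists s, eta => //; exists (N * (2 * C0 * M ^+ d)); first by rewrite !mulr_gt0 ?exprn_gt0.
move=> eps h eps0 [hh _] Hfix.
have entry i j : mnorm (displ h i j) <= 2 * C0 * M ^+ d * eps * tnorm h.
  set w := mnorm _.
  have w0 : 0 <= w by apply: mnorm_ge0.
  have : w <= C0 * (eps * (tnorm h * M ^+ d) + w * (L * eta)).
    apply: (HC _ (iota 1 s)); rewrite ?iota_uniq ?size_iota //.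
    - exact/dhomog_msize_le/displ_homog.
    - by move=> t; rewrite mem_iota add1n ltnS => /andP[].
    - by rewrite addr_ge0 ?mulr_ge0 ?tnorm_ge0 ?exprn_ge0 // ltW.
    move=> [|t]; rewrite mem_iota //= add1n ltnS => ts.
    have [x xy [k lt_k]] := Hfix t ts.
    set y := kronecker_point _ _ in xy *.
    have yM l : nv (y l) <= M by apply: le_trans (HB _ _ ts) _; rewrite /M; lra.
    have eta1 : eta <= 1 by rewrite ge_min lexx.
    have xM l : nv (x l) <= M.
      have := nvD (x l - y l) (y l); rewrite subrK.
      have := xy l; have := HB _ l ts; rewrite -/(y l) /M; lra.
    have yx l : nv (y l - x l) <= eta by rewrite -nvN opprB ltW.
    have at_x : nv (displ h i j).@[x] <= eps * (tnorm h * M ^+ d).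
      apply: (@le_trans _ _ (eps * nv (tnth h k).@[x])).
        apply: le_trans (ltW lt_k); rewrite (bigD1 i) //= (bigD1 j) //= -addrA lerDl.
        by rewrite addr_ge0 // sumr_ge0 // => *; rewrite ?nv_ge0 ?sumr_ge0 // => *;
           apply: nv_ge0.
      rewrite ler_pM2l //; apply: le_trans (meval_bound M1 xM (dhomog_msize_le (hh k))) _.
      by rewrite ler_wpM2r ?tnth_le_tnorm // exprn_ge0 // ltW.
    have := meval_lipschitz M1 (ltW eta0) yM xM yx (dhomog_msize_le (displ_homog i j hh)).
    rewrite -/w -/L => lip.
    have := nvD ((displ h i j).@[y] - (displ h i j).@[x]) (displ h i j).@[x].
    by rewrite subrK => /le_trans; apply; rewrite addrC lerD.
  have : C0 * (w * (L * eta)) <= w / 2.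
    have etaL : eta * (2 * C0 * L) <= 1.
      by rewrite -(ler_pdivlMr _ _ CL0) div1r ge_min lexx orbT.
    have -> : C0 * (w * (L * eta)) = w / 2 * (eta * (2 * C0 * L)) by field.
    by rewrite ler_piMr // divr_ge0.
  rewrite mulrDr => h1 h2.
  have -> : 2 * C0 * M ^+ d * eps * tnorm h = 2 * (C0 * (eps * (tnorm h * M ^+ d))) by ring.
  move: h1 h2; move: (C0 * (w * (L * eta))) (C0 * _) => u v; lra.
apply: (@le_trans _ _ (\sum_(i < n.+1) \sum_(j < n.+1) (2 * C0 * M ^+ d * eps * tnorm h))).
  by apply: ler_sum => i _; apply: ler_sum => j _.
by rewrite !sumr_const card_ord -mulrnA -[X in X <= _]mulr_natl natrM -!mulrA.
Qed.

(** The balls depend on [d], but the condition they impose is open in every degree [d'], as openness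
    in the inductive limit requires. *)
Lemma identity_neighbourhood d (eps : R) : 0 < eps -> exists U : ptup K n -> Prop,
  [/\ openBir U, U (idt K n) & forall h, U h -> in_W d h -> dnorm h <= eps * tnorm h].
Proof.
move=> eps0; have [s [eta eta0 [C C0 HC]]] := fixes_near_bound d.
pose e := eps / C; have e0 : 0 < e by rewrite divr_gt0.
pose V h := forall t, (t < s)%N -> fixes_near e eta (kronecker_point d.+2 t.+1) h.
exists (fun h => birational h /\ V h); split.
- split.
    split=> [h []//|h h' [_ Vh] bh' hh']; split=> // t ts.
    exact: fixes_near_same_map e0 hh' (Vh t ts).
  move=> d' d'1; exists V; split; last by move=> h [_ bh]; split=> [[]|].
  split=> [c h [hh h0] c0 Vh t ts|h Wh Vh].
    apply: fixes_near_same_map e0 _ (Vh t ts); apply: same_map_sym.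
    by apply: same_map_scalet => //; apply: same_map_refl; exists d'.
  apply: near_close => //; apply: near_forall => t ts.
  have [x xy fx] := Vh t ts.
  have [r r0 Hr] := near_fixes_upto e0 Wh.1 fx.
  by exists r => // h' Wh' hh'; exists x => //; apply: Hr.
- split; first exact: birational_idt.
  move=> t ts; exists (kronecker_point d.+2 t.+1); first by move=> i; rewrite subrr nv0.
  exists ord0; rewrite big1 => [|i _]; last first.
    rewrite big1 // => j _; rewrite /displ !tnth_mktuple (mulrC 'X_j) subrr.
    by rewrite meval0 nv0.
  (* The parameter [t.+1] is non-zero, so the first coordinate of the centre is non-zero and the
     identity is defined there. *)
  rewrite mulr_gt0 // tnth_mktuple mevalXU /kronecker_point; apply: nv_gt0.
  by rewrite expf_neq0 // pnatr_eq0.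
move=> h [_ Vh] Wh; have := HC e h e0 Wh Vh.
by rewrite /e mulrCA mulfV ?mulr1 // gt_eqF.
Qed.

Lemma subgroups_cvg_to_id_trivial (G : nat -> ptup K n -> Prop) :
  (forall m, subgroupBir (G m)) -> cvg_to_id G ->
  exists m0, forall m, (m0 <= m)%N -> forall h, G m h -> same_map h (idt K n).
Proof.
move=> Ggrp Gcvg.
have [d [m1 Hdeg]] := cvg_degree_bounded Ggrp Gcvg.
have [eps eps0 Htriv] := small_subgroup_trivial d.
have [U [Uopen Uid Usmall]] := identity_neighbourhood d eps0.
have [m2 HU] := Gcvg U Uopen Uid.
(* The successor turns the strict bounds of [cvg_to_id] into a non-strict one. *)
exists (maxn m1 m2).+1 => m; rewrite gtn_max => /andP[m1m m2m].
apply: Htriv => // [h|h Gh]; first exact: Hdeg.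
by apply: Usmall; apply: HU m2m _ Gh.
Qed.

End Tuples.
End NormedField.

(* k = R (any realType) and k = C = R[i]; n >= 1. *)
Theorem theorem1p2 (R : realType) (n : nat) (hn : (1 <= n)%N) :
  (forall G : nat -> ptup R n -> Prop,
     (forall m, subgroupBir (G m)) -> cvg_to_id G ->
     exists m0, forall m, (m0 <= m)%N ->
       forall h, G m h -> same_map h (idt R n)) /\
  (forall G : nat -> ptup (R[i])%C n -> Prop,
     (forall m, subgroupBir (G m)) -> cvg_to_id G ->
     exists m0, forall m, (m0 <= m)%N ->
       forall h, G m h -> same_map h (idt (R[i])%C n)).
Proof.
split=> G.
  by apply: (@subgroups_cvg_to_id_trivial R R idfun Num.norm).
have normcE (z : R[i]%C) : `|z| = real_complex R (ComplexField.Normc.normc z) by case: z.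
exact: (@subgroups_cvg_to_id_trivial R R[i]%C (real_complex R) _ (@lecR R) normcE n G).
Qed.
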